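(* Let $n\ge 2$ and let $\phi : M^n \rightarrow \mathbb{C}^n$ be a closed Lagrangian homothetic soliton for the inverse mean curvature flow. If $\phi$ is invariant under the action of the special orthogonal group given by $$SO(n)\times \mathbb{C}^{n}\longrightarrow \mathbb{C}^n,\qquad (A,(z_1,\dots,z_n)) \mapsto (z_1,\dots,z_n)A,$$ then $\phi$ is given, up to dilations, by the Hopf immersion $$\mathbb{S}^1 \times \mathbb{S}^{n-1} \rightarrow \mathbb{C}^n, \quad (e^{it},(x_1,\dots,x_n)) \mapsto \sqrt n \, e^{it}\,(x_1,\dots,x_n).$$
   Context: Let $\phi : M^n \to \mathbb{R}^m$ be an isometric immersion of a (connected) $n$-dimensional Riemannian manifold, with second fundamental form $\sigma$ and mean curvature vector $H=\mathrm{trace}\,\sigma$ (not divided by $n$), assumed nowhere vanishing. $\phi$ is called a homothetic soliton for the inverse mean curvature flow if there is a real constant $a\neq 0$ with $-\frac{H}{|H|^2}=a\,\phi^\bot$, where $\phi^\bot$ is the projection of the position vector $\phi$ onto the normal bundle. This condition is invariant under dilations $\phi\mapsto\rho\phi$, $\rho>0$. Closed means compact without boundary. An immersion $\phi:M^n\to\mathbb{C}^n$ is Lagrangian if $\phi^*\omega=0$, where $\omega(\cdot,\cdot)=\langle J\cdot,\cdot\rangle$ and $J$ is the complex structure of $\mathbb{C}^n$. The conclusion ''$\phi$ is given by ...'' is understood at the level of immersed submanifolds, i.e. of the image of the immersion. *)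

(* Defs.v *)
From HB Require Import structures.
From mathcomp Require Import all_boot all_order all_algebra.
From mathcomp Require Import all_classical all_reals all_analysis.
From mathcomp.real_closed Require Import complex.
Set Implicit Arguments.
Unset Strict Implicit.
Unset Printing Implicit Defensive.
Import Order.TTheory GRing.Theory Num.Theory.
Import numFieldNormedType.Exports.
Local Open Scope classical_set_scope.
Local Open Scope ring_scope.

Definition dotv (R : realType) (m : nat) (u v : 'rV[R]_m) : R :=
  \sum_(i < m) u 0 i * v 0 i.

Definition partial (R : realType) (n m : nat) (i : 'I_n)
    (f : 'rV[R]_n -> 'rV[R]_m) (x : 'rV[R]_n) : 'rV[R]_m :=
  'D_(delta_mx 0 i) f x.

(* C^k functions on U; meaningful for U open, as derivatives are two-sided. *)
Fixpoint Ck (R : realType) (n m : nat) (k : nat) (U : set 'rV[R]_n)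
    (f : 'rV[R]_n -> 'rV[R]_m) : Prop :=
  match k with
  | 0%N => forall x, U x -> {for x, continuous f}
  | k'.+1 => [/\ forall x, U x -> {for x, continuous f},
      forall x i, U x -> derivable f x (delta_mx 0 i)
      & forall i, Ck k' U (partial i f)]
  end.

Definition smooth_on (R : realType) (n m : nat) (U : set 'rV[R]_n)
    (f : 'rV[R]_n -> 'rV[R]_m) : Prop :=
  forall k, Ck k U f.

(* [chart_map] only matters on [chart_dom], and [chart_inv] only on
   [chart_cod]; both are arbitrary elsewhere. *)
Record chart (R : realType) (n : nat) (M : Type) := Chart {
  chart_dom : set M;
  chart_map : M -> 'rV[R]_n;
  chart_inv : 'rV[R]_n -> M }.

Definition chart_cod (R : realType) (n : nat) (M : Type)
    (c : chart R n M) : set 'rV[R]_n :=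
  chart_map c @` chart_dom c.

Definition is_chart (R : realType) (n : nat) (M : topologicalType)
    (c : chart R n M) : Prop :=
  [/\ open (chart_dom c), open (chart_cod c),
      forall p, chart_dom c p -> chart_inv c (chart_map c p) = p,
      {within chart_dom c, continuous (chart_map c)}
    & {within chart_cod c, continuous (chart_inv c)}].

Definition smooth_atlas (R : realType) (n : nat) (M : topologicalType)
    (A : set (chart R n M)) : Prop :=
  [/\ forall c, A c -> is_chart c,
      forall p : M, exists2 c, A c & chart_dom c p
    & forall c d, A c -> A d ->
        smooth_on (chart_map c @` (chart_dom c `&` chart_dom d))
                  (chart_map d \o chart_inv c)].

(* Charts have open image in R^n, so manifolds have no boundary. *)
Definition smooth_manifold (R : realType) (n : nat) (M : topologicalType)
    (A : set (chart R n M)) : Prop :=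
  [/\ hausdorff_space M, @second_countable M & smooth_atlas A].

Definition closed_connected (M : topologicalType) : Prop :=
  [/\ [set: M] !=set0, connected [set: M] & compact [set: M]].

Definition immersion (R : realType) (n m : nat) (M : topologicalType)
    (A : set (chart R n M)) (phi : M -> 'rV[R]_m) : Prop :=
  forall c, A c ->
    smooth_on (chart_cod c) (phi \o chart_inv c) /\
    forall x, chart_cod c x -> injective ('d (phi \o chart_inv c) x).

(* Extrinsic geometry of a local parametrization f : R^n -> R^m.  The metric is
   the one induced by f, which is what makes the immersion isometric. *)

Definition first_form (R : realType) (n m : nat)
    (f : 'rV[R]_n -> 'rV[R]_m) (x : 'rV[R]_n) : 'M[R]_n :=
  \matrix_(i, j) dotv (partial i f x) (partial j f x).

(* The rows of ['J f x] are the partial derivatives of f, so its row space is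
   the tangent space and [kermx ('J f x)^T] is the normal space. *)
Definition normal_part (R : realType) (n m : nat)
    (f : 'rV[R]_n -> 'rV[R]_m) (x : 'rV[R]_n) (v : 'rV[R]_m) : 'rV[R]_m :=
  v *m proj_mx (kermx ('J f x)^T) <<'J f x>>%MS.

Definition second_form (R : realType) (n m : nat)
    (f : 'rV[R]_n -> 'rV[R]_m) (x : 'rV[R]_n) (i j : 'I_n) : 'rV[R]_m :=
  normal_part f x (partial i (partial j f) x).

Definition mean_curvature (R : realType) (n m : nat)
    (f : 'rV[R]_n -> 'rV[R]_m) (x : 'rV[R]_n) : 'rV[R]_m :=
  \sum_(i < n) \sum_(j < n)
    invmx (first_form f x) i j *: second_form f x i j.

Definition imcf_homothetic_soliton (R : realType) (n m : nat)
    (M : topologicalType) (A : set (chart R n M)) (phi : M -> 'rV[R]_m) : Prop :=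
  exists2 a : R, a != 0 &
    forall c x, A c -> chart_cod c x ->
      let f := phi \o chart_inv c in
      let H := mean_curvature f x in
      H != 0 /\ - ((dotv H H)^-1 *: H) = a *: normal_part f x (f x).

(* C^n is identified with R^(n + n) by (Re z, Im z). *)

Definition to_real (R : realType) (n : nat) (z : 'rV[R[i]]_n) : 'rV[R]_(n + n) :=
  row_mx (map_mx (@complex.Re R) z) (map_mx (@complex.Im R) z).

Definition of_real (R : realType) (n : nat) (w : 'rV[R]_(n + n)) : 'rV[R[i]]_n :=
  \row_j (w 0 (lshift n j) +i* w 0 (rshift n j))%C.

Definition cplxJ (R : realType) (n : nat) (w : 'rV[R]_(n + n)) :
    'rV[R]_(n + n) :=
  to_real ((0 +i* 1)%C *: of_real w).

Definition omega (R : realType) (n : nat) (u v : 'rV[R]_(n + n)) : R :=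
  dotv (cplxJ u) v.

Definition lagrangian (R : realType) (n : nat) (M : topologicalType)
    (A : set (chart R n M)) (phi : M -> 'rV[R]_(n + n)) : Prop :=
  forall c x, A c -> chart_cod c x ->
    forall u v : 'rV[R]_n,
      omega ('d (phi \o chart_inv c) x u) ('d (phi \o chart_inv c) x v) = 0.

Definition specialO (R : realType) (n : nat) : set 'M[R]_n :=
  [set B | B *m B^T = 1%:M /\ \det B = 1].

Definition SO_act (R : realType) (n : nat) (B : 'M[R]_n) (z : 'rV[R[i]]_n) :
    'rV[R[i]]_n :=
  z *m map_mx (real_complex R) B.

Definition SO_invariant (R : realType) (n : nat) (M : Type)
    (phi : M -> 'rV[R[i]]_n) : Prop :=
  forall B, specialO B -> SO_act B @` range phi = range phi.

Definition hopf (R : realType) (n : nat) (t : R) (x : 'rV[R]_n) : 'rV[R[i]]_n :=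
  ((Num.sqrt n%:R)%:C%C * (cos t +i* sin t)%C) *: map_mx (real_complex R) x.

Definition hopf_image (R : realType) (n : nat) : set 'rV[R[i]]_n :=
  [set z | exists t : R, exists2 x : 'rV[R]_n, dotv x x = 1 & z = hopf t x].

(* Main.v *)
Require Import Defs.
From HB Require Import structures.
From mathcomp Require Import all_boot all_order all_algebra.
From mathcomp Require Import all_classical all_reals all_analysis.
From mathcomp.real_closed Require Import complex.
From mathcomp Require Import ring lra.
Set Implicit Arguments.
Unset Strict Implicit.
Unset Printing Implicit Defensive.
Import Order.TTheory GRing.Theory Num.Theory.
Import numFieldNormedType.Exports.
Local Open Scope classical_set_scope.
Local Open Scope ring_scope.

(** The soliton equation gives <H, phi> = -1/a, so the Laplacian of |phi|^2 is
    the constant 2(n - 1/a).  Looking at a maximum and a minimum of |phi|^2 on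
    the closed manifold forces a = 1/n, and the strong maximum principle then
    makes |phi| constant; hence phi is normal and, by the Lagrangian condition,
    J phi is tangent.

    The image is invariant under SO(n), but its sheets a priori need not be.
    Still, at a point p the velocities of all curves s |-> phi(q(s)) B(s) with
    B(s) in SO(n) are tangent to some sheet through phi(p); there are only
    locally finitely many sheets, so one of them contains T_p and phi(p) so(n),
    and by dimension it is T_p.  Thus the moment map omega(phi X, phi), X in
    so(n), has zero differential.  It is a J-invariant trace-free quadratic form
    evaluated at phi, so its Laplacian is a multiple of its pairing with H,
    that is of its own value, which therefore vanishes (for n = 2 too).
    Hence phi = e^{it} alpha pointwise, with alpha real.

    Finally every phase t occurs: at a maximum of |Re(e^{-it} phi)|^2 the
    derivative in the direction J phi vanishes, which forces
    Im(e^{-it} phi) = 0.  Transitivity of SO(n) on spheres concludes. *)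

(** * Linear algebra of the tangent projection *)

Section Algebra.
Variable R : realType.

Lemma dotvE m (u v : 'rV[R]_m) : dotv u v = (u *m v^T) 0 0.
Proof. by rewrite mxE; apply: eq_bigr => i _; rewrite mxE. Qed.

Lemma dotvC m (u v : 'rV[R]_m) : dotv u v = dotv v u.
Proof. by apply: eq_bigr => i _; rewrite mulrC. Qed.

Lemma dotvDl m (u v w : 'rV[R]_m) : dotv (u + v) w = dotv u w + dotv v w.
Proof. by rewrite !dotvE mulmxDl mxE. Qed.

Lemma dotvZl m a (u v : 'rV[R]_m) : dotv (a *: u) v = a * dotv u v.
Proof. by rewrite !dotvE -scalemxAl mxE. Qed.

Lemma dotvNl m (u v : 'rV[R]_m) : dotv (- u) v = - dotv u v.
Proof. by rewrite !dotvE mulNmx mxE. Qed.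

Lemma dotvBl m (u v w : 'rV[R]_m) : dotv (u - v) w = dotv u w - dotv v w.
Proof. by rewrite dotvDl dotvNl. Qed.

Lemma dotv0l m (u : 'rV[R]_m) : dotv 0 u = 0.
Proof. by rewrite dotvE mul0mx mxE. Qed.

Lemma dotvDr m (u v w : 'rV[R]_m) : dotv u (v + w) = dotv u v + dotv u w.
Proof. by rewrite dotvC dotvDl !(dotvC u). Qed.

Lemma dotvZr m a (u v : 'rV[R]_m) : dotv u (a *: v) = a * dotv u v.
Proof. by rewrite dotvC dotvZl dotvC. Qed.

Lemma dotvNr m (u v : 'rV[R]_m) : dotv u (- v) = - dotv u v.
Proof. by rewrite dotvC dotvNl dotvC. Qed.

Lemma dotvBr m (u v w : 'rV[R]_m) : dotv u (v - w) = dotv u v - dotv u w.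
Proof. by rewrite dotvDr dotvNr. Qed.

Lemma dotv0r m (u : 'rV[R]_m) : dotv u 0 = 0.
Proof. by rewrite dotvC dotv0l. Qed.

Lemma dotv_mull m p (u : 'rV[R]_m) (S : 'M[R]_(m, p)) v :
  dotv (u *m S) v = dotv u (v *m S^T).
Proof. by rewrite !dotvE trmx_mul trmxK mulmxA. Qed.

Lemma dotv_suml (I : finType) m (F : I -> 'rV[R]_m) v :
  dotv (\sum_i F i) v = \sum_i dotv (F i) v.
Proof.
by apply: (big_morph (fun x => dotv x v)) => [x y|]; rewrite ?dotvDl ?dotv0l.
Qed.

Lemma dotv_ge0 m (u : 'rV[R]_m) : 0 <= dotv u u.
Proof. by apply: sumr_ge0 => i _; rewrite -expr2 sqr_ge0. Qed.

Lemma dotv_eq0 m (u : 'rV[R]_m) : (dotv u u == 0) = (u == 0).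
Proof.
apply/eqP/eqP => [/eqP|->]; last by rewrite dotv0l.
rewrite psumr_eq0 => [/allP u0|i _]; last by rewrite -expr2 sqr_ge0.
apply/rowP => i; apply/eqP.
by have := u0 i (mem_index_enum i); rewrite mulf_eq0 orbb mxE.
Qed.

Lemma dotv_gt0 m (u : 'rV[R]_m) : u != 0 -> 0 < dotv u u.
Proof. by move=> u0; rewrite lt_def dotv_eq0 u0 dotv_ge0. Qed.

Lemma dotv_eq0P m (u : 'rV[R]_m) : (forall v, dotv u v = 0) -> u = 0.
Proof. by move=> /(_ u)/eqP; rewrite dotv_eq0 => /eqP. Qed.

Lemma dotv_delta m (u : 'rV[R]_m) i : dotv u (delta_mx 0 i) = u 0 i.
Proof.
rewrite /dotv (bigD1 i)//= big1 => [|j ji]; rewrite !mxE !eqxx/= ?mulr1 ?addr0//.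
by rewrite (negbTE ji) mulr0.
Qed.

Lemma sqr_coord_le_dotv m (u : 'rV[R]_m) i : u 0 i ^+ 2 <= dotv u u.
Proof.
rewrite /dotv (bigD1 i)//= expr2 lerDl; apply: sumr_ge0 => j _.
by rewrite -expr2 sqr_ge0.
Qed.

(** If [v *m P *m P^T = 0], pairing with [v] gives [|v P|^2 = 0], so [v *m P = 0]. *)
Lemma gram_unit n m (P : 'M[R]_(n, m)) : row_free P -> P *m P^T \in unitmx.
Proof.
move=> fP; rewrite -row_free_unit; apply: inj_row_free => v vPP.
apply: (row_free_inj fP); rewrite mul0mx; apply/eqP; rewrite -dotv_eq0.
by rewrite dotvE trmx_mul mulmxA -(mulmxA v) vPP mul0mx mxE.
Qed.

(** For [row_free P], the orthogonal projector onto the row space of [P], acting on row vectors from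
    the right. The closed formula gives its symmetry and trace directly, which [proj_mx] does
    not. *)
Definition tproj n m (P : 'M[R]_(n, m)) : 'M[R]_m :=
  P^T *m invmx (P *m P^T) *m P.

Lemma tproj_sym n m (P : 'M[R]_(n, m)) : (tproj P)^T = tproj P.
Proof.
by rewrite /tproj !trmx_mul trmx_inv trmx_mul !trmxK mulmxA.
Qed.

Lemma mulmx_tproj n m (P : 'M[R]_(n, m)) : row_free P -> P *m tproj P = P.
Proof. by move=> /gram_unit uP; rewrite /tproj !mulmxA mulmxV// mul1mx. Qed.

Lemma tproj_tr n m (P : 'M[R]_(n, m)) : row_free P -> tproj P *m P^T = P^T.
Proof.
by move=> fP; rewrite -[in LHS]tproj_sym -trmx_mul mulmx_tproj.
Qed.

(** Kernel and row space meet trivially, since a vector in both is orthogonal to itself. So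
    [proj_mx] can be evaluated on each summand of [v = (v - v *m tproj P) + v *m tproj P]. *)
Lemma normal_proj n m (P : 'M[R]_(n, m)) (v : 'rV[R]_m) : row_free P ->
  v *m proj_mx (kermx P^T) <<P>>%MS = v - v *m tproj P.
Proof.
move=> fP; have cap0 : (kermx P^T :&: <<P>> = 0)%MS.
  apply/eqP/rowV0P => u; rewrite sub_capmx genmxE => /andP[/sub_kermxP uP].
  move=> /submxP[w uE]; apply/eqP; rewrite -dotv_eq0 uE dotvE trmx_mul mulmxA.
  by rewrite -uE uP mul0mx mxE.
rewrite -{1}[v](subrK (v *m tproj P)) mulmxDl proj_mx_id//; last first.
  apply/sub_kermxP; rewrite mulmxBl /tproj -!mulmxA mulVmx ?gram_unit//.
  by rewrite mulmx1 subrr.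
rewrite proj_mx_0 ?addr0// genmxE /tproj.
by apply/submxP; exists (v *m (P^T *m invmx (P *m P^T))); rewrite !mulmxA.
Qed.

(** Right multiplication sends [(x, y)] to [(-y, x)], which is multiplication by i on [x + iy]. *)
Definition cplxJ_mx n : 'M[R]_(n + n) := block_mx 0 1%:M (- 1%:M) 0.

Lemma cplxJE n (w : 'rV[R]_(n + n)) : cplxJ w = w *m cplxJ_mx n.
Proof.
rewrite -[in RHS](hsubmxK w) /cplxJ_mx mul_row_block !mulmx0 mulmx1 mulmxN mulmx1.
rewrite addr0 add0r /cplxJ /to_real; congr row_mx; apply/rowP => i.
  by rewrite !mxE/= mul0r mul1r sub0r.
by rewrite !mxE/= mul0r mul1r add0r.
Qed.

Lemma cplxJ_mxN n : (cplxJ_mx n)^T = - cplxJ_mx n.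
Proof.
by rewrite /cplxJ_mx tr_block_mx opp_block_mx !linearN/= !trmx0 trmx1 !oppr0 !opprK.
Qed.

Lemma cplxJ_mxK n : cplxJ_mx n *m (cplxJ_mx n)^T = 1%:M.
Proof.
rewrite cplxJ_mxN mulmxN /cplxJ_mx mulmx_block !mul0mx !mulmx0 !mul1mx !mulmx1.
by rewrite !addr0 !add0r opp_block_mx opprK oppr0 -scalar_mx_block.
Qed.

(* The rows of [P] and [P *m J] together form a basis whose Gram matrix is
   block-diagonal with equal blocks; inverting it resolves the identity. *)
Lemma lagrangian_tproj n (P : 'M[R]_(n, n + n)) : row_free P ->
  P *m cplxJ_mx n *m P^T = 0 ->
  tproj P + (cplxJ_mx n)^T *m tproj P *m cplxJ_mx n = 1%:M.
Proof.
move=> fP; set J := cplxJ_mx n; set g := P *m P^T => PJP.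
have ug : g \in unitmx := gram_unit fP.
pose C := col_mx P (P *m J).
pose D := block_mx (invmx g) 0 0 (invmx g).
have CC : C *m (C^T *m D) = 1%:M.
  rewrite mulmxA tr_col_mx mul_col_row trmx_mul !mulmxA PJP.
  rewrite -[P *m J *m J^T]mulmxA cplxJ_mxK mulmx1 cplxJ_mxN mulmxN mulNmx.
  rewrite PJP oppr0 mulmx_block !mulmx0 !mul0mx !addr0 !add0r mulmxV//.
  by rewrite -scalar_mx_block.
rewrite -(mulmx1C CC) /C /D tr_col_mx mul_row_block !mulmx0 addr0 add0r mul_row_col.
by rewrite trmx_mul /tproj !mulmxA.
Qed.

(** J exchanges the normal and tangent spaces of a Lagrangian: in the resolution of the identity
    applied to a normal [w], the tangential term dies and [w] is recovered from the projection of
    [w J^T = - w J]. *)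
Lemma lagrangian_normalJ n (P : 'M[R]_(n, n + n)) (w : 'rV[R]_(n + n)) :
  row_free P -> P *m cplxJ_mx n *m P^T = 0 -> w *m P^T = 0 ->
  w *m cplxJ_mx n *m tproj P = w *m cplxJ_mx n.
Proof.
move=> fP PJP wP; have := lagrangian_tproj fP PJP.
move=> /(congr1 (mulmx w)); rewrite mulmx1 mulmxDr [X in X + _]mulmxA.
rewrite {1}/tproj !mulmxA wP !mul0mx add0r => wE.
rewrite -[in RHS]wE -[RHS]mulmxA.
have -> : cplxJ_mx n *m cplxJ_mx n = - 1%:M.
  by rewrite -(cplxJ_mxK n) cplxJ_mxN mulmxN opprK.
by rewrite cplxJ_mxN !mulmxN !mulNmx mulmx1 opprK.
Qed.

(** Conjugation by J turns the tangent projector into the normal one. Since [S] commutes with J, its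
    traces against both projectors agree, and they add up to [\tr S = 0]. *)
Lemma lagrangian_trace n (P : 'M[R]_(n, n + n)) (S : 'M[R]_(n + n)) :
  row_free P -> P *m cplxJ_mx n *m P^T = 0 ->
  S *m cplxJ_mx n = cplxJ_mx n *m S -> \tr S = 0 -> \tr (S *m tproj P) = 0.
Proof.
move=> fP PJP SJ trS; have := lagrangian_tproj fP PJP.
move=> /(congr1 (fun B => \tr (S *m B))); rewrite mulmx1 trS mulmxDr mxtraceD.
suff -> : \tr (S *m ((cplxJ_mx n)^T *m tproj P *m cplxJ_mx n)) =
  \tr (S *m tproj P) by move=> h; lra.
rewrite mulmxA mxtrace_mulC !mulmxA -SJ.
by rewrite -(mulmxA S (cplxJ_mx n)) cplxJ_mxK mulmx1.
Qed.

End Algebra.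

(** * Derivatives of vector-valued functions *)

Section Calculus.
Variable R : realType.

Lemma coord_le_norm m (v : 'rV[R]_m) i : `|v 0 i| <= `|v|.
Proof.
rewrite [leRHS]/Num.Def.normr/= mx_normrE.
by apply: le_trans (le_bigmax _ _ (0, i)).
Qed.

Lemma norm_le_coord m (v : 'rV[R]_m) (e : R) : 0 <= e ->
  (forall i, `|v 0 i| <= e) -> `|v| <= e.
Proof.
move=> e0 ve; rewrite [leLHS]/Num.Def.normr/= mx_normrE bigmax_le// => -[i j] _ /=.
by rewrite (ord1 i).
Qed.

Lemma is_derive_line (V W : normedModType R) (g : V -> W) z v (t : R) :
  derivable g (z + t *: v) v ->
  is_derive t 1 (fun s : R => g (z + s *: v)) ('D_v g (z + t *: v)).
Proof.
move=> gv; have E : (fun h : R => h^-1 *: (((fun s : R => g (z + s *: v)) \o shift t)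
    (h *: 1) - g (z + t *: v))) =
  (fun h : R => h^-1 *: ((g \o shift (z + t *: v)) (h *: v) - g (z + t *: v))).
  apply/funext => h /=; congr (_ *: (g _ - _)).
  by rewrite [h *: 1]mulr1 scalerDl addrCA.
by apply: DeriveDef; rewrite ?/derivable ?/derive E.
Qed.

Lemma is_derive_coord m (u : R -> 'rV[R]_m) (t : R) (du : 'rV[R]_m) i :
  is_derive t 1 u du -> is_derive t 1 (fun s => u s 0 i) (du 0 i).
Proof.
move=> -[du1 <-]; apply: DeriveDef; first exact: ((derivable_mxP _ _ _).1 du1).
by rewrite derive_mx// mxE.
Qed.

Lemma is_derive_row m (u : R -> 'rV[R]_m) (t : R) (du : 'rV[R]_m) :
  (forall i, is_derive t 1 (fun s => u s 0 i) (du 0 i)) -> is_derive t 1 u du.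
Proof.
move=> ui; have ud : derivable u t 1.
  by apply: (derivable_mxP _ _ _).2 => i j; rewrite (ord1 i); have [] := ui j.
apply: DeriveDef => //; rewrite derive_mx//; apply/rowP => j.
by rewrite mxE; have [_ <-] := ui j.
Qed.

Lemma is_derive_sum_ord m (h : 'I_m -> R -> R) (t : R) (dh : 'I_m -> R) :
  (forall i, is_derive t 1 (h i) (dh i)) ->
  is_derive t 1 (fun s => \sum_(i < m) h i s) (\sum_(i < m) dh i).
Proof. by move=> /is_derive_sum; rewrite fct_sumE. Qed.

Lemma is_derive_mul (u v : R -> R) (t du dv : R) :
  is_derive t 1 u du -> is_derive t 1 v dv ->
  is_derive t 1 (fun s => u s * v s) (du * v t + u t * dv).
Proof.
move=> ud vd; have := is_deriveM ud vd.
by rewrite addrC [du * _]mulrC.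
Qed.

Lemma is_derive_mulmxr m p (u : R -> 'rV[R]_m) (t : R) (du : 'rV[R]_m) (S : 'M[R]_(m, p)) :
  is_derive t 1 u du -> is_derive t 1 (fun s => u s *m S) (du *m S).
Proof.
move=> ud; apply: is_derive_row => j.
have -> : (fun s => (u s *m S) 0 j) = (fun s => \sum_k u s 0 k * S k j).
  by apply/funext => s; rewrite mxE.
rewrite mxE; apply: is_derive_sum_ord => k.
have := is_derive_mul (is_derive_coord k ud) (is_derive_cst (S k j) t 1).
by rewrite mulr0 addr0.
Qed.

Lemma is_derive_dotv m (u v : R -> 'rV[R]_m) (t : R) (du dv : 'rV[R]_m) :
  is_derive t 1 u du -> is_derive t 1 v dv ->
  is_derive t 1 (fun s => dotv (u s) (v s)) (dotv du (v t) + dotv (u t) dv).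
Proof.
move=> ud vd; rewrite /dotv -big_split/=; apply: is_derive_sum_ord => k.
exact: is_derive_mul (is_derive_coord k ud) (is_derive_coord k vd).
Qed.

Lemma is_deriveZrow m (a : R -> R) (u : 'rV[R]_m) (t da : R) :
  is_derive t 1 a da -> is_derive t 1 (fun s => a s *: u) (da *: u).
Proof.
move=> ad; apply: is_derive_row => j.
have -> : (fun s => (a s *: u) 0 j) = (fun s => a s * u 0 j).
  by apply/funext => s; rewrite mxE.
by have := is_derive_mul ad (is_derive_cst (u 0 j) t 1); rewrite mulr0 addr0 mxE.
Qed.

(** The mean value theorem is applied to each component separately. The intermediate point depends
    on the component, but the bound [e] holds along the whole segment and the norm is the maximum of
    the components. *)
Lemma coord_mean_value n m (f : 'rV[R]_n -> 'rV[R]_m) (i : 'I_n)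
    (z : 'rV[R]_n) (h e : R) (c : 'rV[R]_m) :
  0 <= e ->
  (forall s : R, `|s| <= `|h| -> derivable f (z + s *: delta_mx 0 i) (delta_mx 0 i) /\
     `|partial i f (z + s *: delta_mx 0 i) - c| <= e) ->
  `|f (z + h *: delta_mx 0 i) - f z - h *: c| <= `|h| * e.
Proof.
move=> e0 fd; apply: norm_le_coord => [|l]; first by rewrite mulr_ge0.
set d := delta_mx 0 i in fd *.
pose g (s : R) : R := f (z + s *: d) 0 l.
pose dg (s : R) : R := partial i f (z + s *: d) 0 l.
have gd (s : R) : `|s| <= `|h| -> is_derive s 1 g (dg s).
  move=> /fd[fds _]; apply: is_derive_coord.
  exact: is_derive_line.
have gc (a b : R) : (forall s, a <= s <= b -> `|s| <= `|h|) ->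
    {within `[a, b], continuous g}.
  move=> ab; apply: derivable_within_continuous => s sab.
  by have /ab/gd[] : a <= s <= b by move: sab; rewrite in_itv.
have gm s : `|s| <= `|h| -> g h - g 0 = dg s * h ->
    `|(f (z + h *: d) - f z - h *: c) 0 l| <= `|h| * e.
  move=> sh ghE; have -> : (f (z + h *: d) - f z - h *: c) 0 l = h * (dg s - c 0 l).
    by move: ghE; rewrite /g scale0r addr0 !mxE mulrBr [h * dg s]mulrC => ->.
  rewrite normrM ler_wpM2l//; have [_ ] := fd _ sh; apply: le_trans.
  by have := coord_le_norm (partial i f (z + s *: d) - c) l; rewrite !mxE.
have [h0|h0|h0] := ltgtP h 0.
- have ab s : h <= s <= 0 -> `|s| <= `|h|.
    by move=> /andP[hs s0]; rewrite !ler0_norm ?lerN2 ?(ltW h0).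
  have gI s : s \in `]h, 0[ -> is_derive s 1 g (dg s).
    by rewrite in_itv => /andP[sl sr]; apply/gd/ab; rewrite !ltW.
  have [s sI E] := MVT h0 gI (gc _ _ ab).
  apply: (gm s); first by apply: ab; move: sI; rewrite in_itv => /andP[/ltW-> /ltW->].
  by rewrite -opprB E sub0r mulrN opprK.
- have ab s : 0 <= s <= h -> `|s| <= `|h|.
    by move=> /andP[s0 sh]; rewrite !ger0_norm ?(ltW h0).
  have gI s : s \in `]0, h[ -> is_derive s 1 g (dg s).
    by rewrite in_itv => /andP[sl sr]; apply/gd/ab; rewrite !ltW.
  have [s sI E] := MVT h0 gI (gc _ _ ab).
  apply: (gm s); first by apply: ab; move: sI; rewrite in_itv => /andP[/ltW-> /ltW->].
  by rewrite E subr0.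
- by rewrite h0 !scale0r addr0 subrr subr0 mxE normr0 mul0r.
Qed.

End Calculus.

(** * Differentiability of C^1 maps *)

Section Differentiability.
Variable R : realType.

Lemma nbhs_distP (V : normedModType R) (x : V) (P : V -> Prop) :
  (\forall y \near x, P y) <->
  exists2 d : R, 0 < d & forall y, `|y - x| < d -> P y.
Proof.
split=> [/nbhs_normP[d d0 dP]|[d d0 dP]].
  by exists d => // y yd; apply: dP; rewrite /= distrC.
by apply/nbhs_normP; exists d => // y /= yd; apply: dP; rewrite distrC.
Qed.

Lemma norm_mulmx_le n m (v : 'rV[R]_n) (P : 'M[R]_(n, m)) :
  `|v *m P| <= `|v| * \sum_i \sum_j `|P i j|.
Proof.
have S0 : 0 <= \sum_i \sum_j `|P i j| by apply: sumr_ge0 => i _; apply: sumr_ge0.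
apply: norm_le_coord => [|j]; first by rewrite mulr_ge0.
rewrite mxE mulr_sumr; apply: le_trans (ler_norm_sum _ _ _) _.
apply: ler_sum => i _; rewrite normrM ler_pM ?coord_le_norm//.
by rewrite (bigD1 j)//= lerDl; apply: sumr_ge0.
Qed.

Lemma mulmxr_continuous n m (P : 'M[R]_(n, m)) :
  continuous (mulmxr P : 'rV[R]_n -> 'rV[R]_m).
Proof.
move=> v; apply/(@cvgrPdist_le _ _ _ (nbhs v)) => e e0.
set C := \sum_i \sum_j `|P i j|.
have C0 : 0 <= C by apply: sumr_ge0 => i _; apply: sumr_ge0.
have eC : 0 < e / (C + 1) by rewrite divr_gt0// ltr_wpDl.
apply: (nbhs_normP v _).2; exists (e / (C + 1)) => // u /= /ltW ue.
rewrite -mulmxBl; apply: le_trans (norm_mulmx_le _ _) _.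
apply: (@le_trans _ _ (e / (C + 1) * C)).
  exact: ler_wpM2r.
rewrite mulrAC ler_pdivrMr ?ltr_wpDl// ler_wpM2l ?(ltW e0)//.
by rewrite lerDl.
Qed.

(** Go from [x] to [y] changing one coordinate at a time and apply [coord_mean_value] on each leg,
    where the partial derivatives are close to those at [x]. *)
Lemma C1_approx n m (U : set 'rV[R]_n) (f : 'rV[R]_n -> 'rV[R]_m) (x : 'rV[R]_n) :
  open U -> Ck 1 U f -> U x -> forall e : R, 0 < e ->
  \forall y \near x,
    `|f y - f x - (y - x) *m \matrix_i partial i f x| <= e * `|y - x|.
Proof.
move=> oU [_ fd fc] Ux e e0.
(* There are [n] legs; dividing by [n.+1] also covers [n = 0]. *)
have e'0 : 0 < e / n.+1%:R by rewrite divr_gt0.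
have : \forall z \near x, U z /\ forall i : 'I_n,
    `|partial i f z - partial i f x| <= e / n.+1%:R.
  near=> z; split; first by near: z; apply: open_nbhs_nbhs.
  move=> i; move: i; near: z; apply: filter_forall => i.
  near=> z; rewrite distrC; near: z.
  have /= := fc i x Ux; move/cvgrPdist_le; exact.
move=> /nbhs_distP[d d0 dP]; near=> y.
have yd : `|y - x| < d.
  by near: y; apply: (nbhs_distP x _).2; exists d.
pose q (k : nat) : 'rV[R]_n := \row_j (if (j < k)%N then y 0 j else x 0 j).
have q0 : q 0%N = x by apply/rowP => j; rewrite mxE.
have qn : q n = y by apply/rowP => j; rewrite mxE ltn_ord.
have qS (k : 'I_n) : q k.+1 = q k + (y - x) 0 k *: delta_mx 0 k.
  apply/rowP => j; rewrite !mxE/= ltnS leq_eqVlt -val_eqE /=.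
  by case: ltngtP => //= [||/val_inj->]; rewrite ?mulr0 ?addr0// mulr1 addrC subrK.
have -> : f y - f x = \sum_(k < n) (f (q k.+1) - f (q k)).
  by rewrite -q0 -{1}qn -(telescope_sumr (f \o q))// big_mkord.
rewrite mulmx_sum_row -sumrB; apply: le_trans (ler_norm_sum _ _ _) _.
apply: (@le_trans _ _ (\sum_(k < n) (`|y - x| * (e / n.+1%:R)))).
  apply: ler_sum => k _; rewrite rowK qS.
  apply: (@le_trans _ _ (`|(y - x) 0 k| * (e / n.+1%:R))); last first.
    by rewrite ler_wpM2r ?coord_le_norm// ltW.
  apply: coord_mean_value => [|s sk]; first exact: ltW.
  have /dP[Uz dz] : `|q k + s *: delta_mx 0 k - x| < d.
    apply: le_lt_trans yd.
    apply: norm_le_coord => // j; rewrite !mxE/=.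
    have [->|jk] := eqVneq j k.
      rewrite ltnn mulr1 addrAC subrr add0r.
      exact: le_trans sk (coord_le_norm _ _).
    rewrite mulr0 addr0; case: ifP => _; last by rewrite subrr normr0.
    by have := coord_le_norm (y - x) j; rewrite !mxE.
  by split => //; apply: fd.
rewrite sumr_const card_ord -[leLHS]mulr_natr -mulrA mulrC.
rewrite ler_wpM2r// mulrAC ler_pdivrMr// ler_wpM2l ?(ltW e0)//.
by rewrite ler_nat.
Unshelve. all: by end_near. Qed.

Lemma approx_diff n m (f : 'rV[R]_n -> 'rV[R]_m) (x : 'rV[R]_n) (P : 'M[R]_(n, m)) :
  (forall e : R, 0 < e ->
    \forall y \near x, `|f y - f x - (y - x) *m P| <= e * `|y - x|) ->
  differentiable f x /\ 'J f x = P.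
Proof.
move=> fP; pose df : {linear 'rV[R]_n -> 'rV[R]_m} := mulmxr P.
have dfc : continuous df := @mulmxr_continuous _ _ P.
have fE : f \o shift x = cst (f x) + df +o_ (0 : 'rV[R]_n) id.
  apply/eqaddoP => e e0; have := fP e e0; rewrite (near_shift 0 x).
  apply: filterS => h /=; rewrite subr0 addrK.
  by rewrite -[(f \o _ - _) h]/(f (h + x) - (f x + h *m P)) opprD addrA.
have dE := diff_unique dfc fE.
have fd : differentiable f x by apply/diff_locallyP; rewrite dE.
split => //; apply/row_matrixP => i; rewrite !rowE.
by rewrite /jacobian mul_rV_lin1 /= dE.
Qed.

Lemma approx_derive n m (f : 'rV[R]_n -> 'rV[R]_m) (x : 'rV[R]_n) v :
  differentiable f x -> derivable f x v /\ 'D_v f x = v *m 'J f x.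
Proof.
by move=> fd; split; [exact: diff_derivable|rewrite deriveEjacobian].
Qed.

Lemma C1_differentiable n m (U : set 'rV[R]_n) (f : 'rV[R]_n -> 'rV[R]_m) (x : 'rV[R]_n) :
  open U -> Ck 1 U f -> U x -> differentiable f x.
Proof. by move=> oU cf Ux; have [] := approx_diff (C1_approx oU cf Ux). Qed.

Lemma row_jacobian n m (f : 'rV[R]_n -> 'rV[R]_m) (x : 'rV[R]_n) i :
  differentiable f x -> row i ('J f x) = partial i f x.
Proof. by move=> fd; rewrite rowE -deriveEjacobian. Qed.

End Differentiability.

(** * Continuity of matrix-valued maps *)

Section MatrixContinuity.
Variable R : realType.

Lemma cvg_mxP (T : Type) (F : set_system T) {FF : Filter F} m n
    (A : T -> 'M[R]_(m, n)) (a : 'M[R]_(m, n)) :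
  A x @[x --> F] --> a <-> forall i j, A x i j @[x --> F] --> a i j.
Proof.
split=> [Ac i j|Ac].
  exact: (@cvg_comp _ _ _ A (fun M : 'M[R]_(m, n) => M i j) _ _ _ Ac
    (@coord_continuous R m n i j a)).
apply/(@cvgrPdist_le _ _ _ F) => e e0.
have : \forall y \near F, forall ij : 'I_m * 'I_n,
    `|a ij.1 ij.2 - A y ij.1 ij.2| <= e.
  apply: filter_forall => -[i j] /=.
  by have /cvgrPdist_le := Ac i j; apply.
apply: filterS => y yP; rewrite [leLHS]/Num.Def.normr/= mx_normrE.
by apply: bigmax_le => [|ij _]; [exact: ltW|rewrite !mxE].
Qed.

Lemma cvg_mulmx (T : Type) (F : set_system T) {FF : Filter F} m n p
    (A : T -> 'M[R]_(m, n)) (B : T -> 'M[R]_(n, p)) (a : 'M[R]_(m, n))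
    (b : 'M[R]_(n, p)) : A x @[x --> F] --> a -> B x @[x --> F] --> b ->
  (A x *m B x) @[x --> F] --> a *m b.
Proof.
move=> /cvg_mxP Ac /cvg_mxP Bc; apply/cvg_mxP => i j; rewrite mxE.
have -> : (fun y => (A y *m B y) i j) = (fun y => \sum_k A y i k * B y k j).
  by apply/funext => y; rewrite mxE.
apply: cvg_big => [|k _]; first exact: add_continuous.
exact: cvgM (Ac i k) (Bc k j).
Qed.

Lemma continuous_mxP (V : topologicalType) m n (A : V -> 'M[R]_(m, n)) (x : V) :
  {for x, continuous A} <-> forall i j, {for x, continuous (fun y => A y i j)}.
Proof. exact: cvg_mxP. Qed.

Lemma continuous_mulmx (V : topologicalType) m n p (A : V -> 'M[R]_(m, n))
    (B : V -> 'M[R]_(n, p)) (x : V) :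
  {for x, continuous A} -> {for x, continuous B} ->
  {for x, continuous (fun y => A y *m B y)}.
Proof. exact: cvg_mulmx. Qed.

Lemma continuous_sumr (V : topologicalType) (I : finType)
    (F : I -> V -> R) (x : V) : (forall i, {for x, continuous (F i)}) ->
  {for x, continuous (fun y => \sum_i F i y)}.
Proof.
move=> Fc; rewrite /prop_for /continuous_at.
by apply: cvg_big => [|i _]; [exact: add_continuous|exact: Fc].
Qed.

Lemma continuous_tr (V : topologicalType) m n (A : V -> 'M[R]_(m, n)) (x : V) :
  {for x, continuous A} -> {for x, continuous (fun y => (A y)^T)}.
Proof.
move=> /continuous_mxP Ac; apply/continuous_mxP => i j.
by have -> : (fun y => (A y)^T i j) = (fun y => A y j i)
  by apply/funext => y; rewrite mxE.
Qed.

Lemma continuous_dotv (V : topologicalType) m (u v : V -> 'rV[R]_m) (x : V) :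
  {for x, continuous u} -> {for x, continuous v} ->
  {for x, continuous (fun y => dotv (u y) (v y))}.
Proof.
move=> uc vc; have -> : (fun y => dotv (u y) (v y)) =
    (fun y => (u y *m (v y)^T) 0 0) by apply/funext => y; rewrite dotvE.
by move: (continuous_mulmx uc (continuous_tr vc)) => /continuous_mxP.
Qed.

Lemma continuous_trace (V : topologicalType) m (A : V -> 'M[R]_m) (x : V) :
  {for x, continuous A} -> {for x, continuous (fun y => \tr (A y))}.
Proof.
move=> /continuous_mxP Ac; rewrite /prop_for /continuous_at /mxtrace.
apply: cvg_big => [|k _]; first exact: add_continuous.
exact: Ac.
Qed.

Lemma continuous_det (V : topologicalType) m (A : V -> 'M[R]_m) (x : V) :
  {for x, continuous A} -> {for x, continuous (fun y => \det (A y))}.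
Proof.
move=> /continuous_mxP Ac; rewrite /prop_for /continuous_at /determinant.
apply: cvg_big => [|s _]; first exact: add_continuous.
apply: cvgM; first exact: cvg_cst.
by apply: cvg_big => [|i _]; [exact: mul_continuous|exact: Ac].
Qed.

(** The determinant stays nonzero near [x], and there [invmx] is given by the cofactor formula
    instead of its default value on singular matrices. *)
Lemma continuous_invmx (V : topologicalType) m (A : V -> 'M[R]_m) (x : V) :
  A x \in unitmx ->
  {for x, continuous A} -> {for x, continuous (fun y => invmx (A y))}.
Proof.
move=> uA Ac; have dAc := continuous_det Ac.
have dA0 : \det (A x) != 0 by rewrite -unitfE -unitmxE.
apply/continuous_mxP => i j; rewrite /prop_for /continuous_at.
have -> : invmx (A x) i j = (\det (A x))^-1 * cofactor (A x) j i.
  by rewrite /invmx uA !mxE.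
have E : {near x, (fun y => (\det (A y))^-1 * cofactor (A y) j i) =1
    (fun y => invmx (A y) i j)}.
  have : \forall y \near x, \det (A y) != 0 by exact: cvgr_neq0 dAc dA0.
  by apply: filterS => y dy; rewrite /invmx unitmxE unitfE dy !mxE.
apply: cvg_trans (near_eq_cvg E) _.
apply: cvgM; first exact: cvgV.
rewrite /cofactor; apply: cvgM; first exact: cvg_cst.
apply: (@continuous_det _ _ (fun y => row' j (col' i (A y))) x); apply/continuous_mxP => k l.
have -> : (fun y => row' j (col' i (A y)) k l) =
    (fun y => A y (lift j k) (lift i l)).
  by apply/funext => y; rewrite !mxE.
by move/continuous_mxP: Ac.
Qed.

End MatrixContinuity.

(** * The strong maximum principle *)

Section MaximumPrinciple.
Variable R : realType.

(** If [g2] were positive, [G1] would be positive just to the right of 0, and by the mean value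
    theorem [G] would exceed [G 0] there. *)
Lemma second_derivative_test (G G1 : R -> R) (g2 d : R) : 0 < d ->
  (forall t : R, `|t| < d -> is_derive t 1 G (G1 t) /\ G t <= G 0) ->
  is_derive (0 : R) 1 G1 g2 -> G1 0 = 0 /\ g2 <= 0.
Proof.
move=> d0 Gd G1d; have I0 : (0 : R) \in `](- d), d[ by rewrite in_itv/= oppr_lt0 d0.
have Iabs t : t \in `](- d), d[ -> `|t| < d by rewrite in_itv/= ltr_norml.
have [dG0 G10] : is_derive (0 : R) 1 G 0.
  apply: (@derive1_at_max _ G (- d) d) => // [|t /Iabs/Gd[[]]|t /Iabs/Gd[]]//.
  by lra.
have G10E : G1 0 = 0.
  by have [[_ <-] _] := Gd 0 (Iabs _ I0).
split=> //; rewrite leNgt; apply/negP => g20.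
have [dG1 G1E] := G1d.
have : \forall h \near 0^', 0 < h^-1 *: (G1 (h *: 1 + 0) - G1 0).
  by move: g20; rewrite -G1E; apply: cvgr_gt; exact: dG1.
move=> /nbhs_ballP[e /= e0 eP].
pose h := Num.min d e / 2.
have m0 : 0 < Num.min d e by rewrite lt_min d0.
have h0 : 0 < h by rewrite divr_gt0.
have hm : h < Num.min d e by rewrite ltr_pdivrMr// ltr_pMr// ltr1n.
have /andP[hd he] : (h < d) && (h < e) by rewrite -lt_min.
have Gd' (t : R) : 0 <= t <= h -> is_derive t 1 G (G1 t).
  by move=> /andP[t0 th]; apply: (Gd _ _).1; rewrite ger0_norm// (le_lt_trans th).
have gI (t : R) : t \in `]0, h[ -> is_derive t 1 G (G1 t).
  by rewrite in_itv/= => /andP[t0 th]; apply: Gd'; rewrite !ltW.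
have gc : {within `[0, h], continuous G}.
  apply: derivable_within_continuous => t; rewrite in_itv/= => /Gd'.
  by case.
have [c] := MVT h0 gI gc; rewrite in_itv/= subr0 => /andP[c0 ch] GE.
have := (Gd h _).2; rewrite ger0_norm ?(ltW h0)// => /(_ hd).
rewrite -subr_le0 GE; apply/negP; rewrite -ltNge mulr_gt0//.
have ec : ball (0 : R) e c.
  by rewrite -ball_normE /= sub0r normrN ger0_norm ?(ltW c0)// (lt_trans ch).
have := eP c ec (lt0r_neq0 c0).
by rewrite addr0 G10E subr0 [c *: 1]mulr1 pmulr_rgt0// invr_gt0.
Qed.

(** [D1 y b] and [D2 y b] play the first and second derivatives of [F] at [y] along the line of
    direction [b]. Keeping them as data lets explicit formulas be supplied, and derivatives along
    lines suffice for the maximum principle. *)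
Definition C2_data n (U : set 'rV[R]_n) (F : 'rV[R]_n -> R)
    (D1 D2 : 'rV[R]_n -> 'rV[R]_n -> R) : Prop :=
  (forall x b (t : R), U (x + t *: b) ->
    is_derive t 1 (fun s => F (x + s *: b)) (D1 (x + t *: b) b)) /\
  (forall x b, U x -> is_derive (0 : R) 1 (fun s => D1 (x + s *: b) b) (D2 x b)).

Lemma line_near n (U : set 'rV[R]_n) x b : open U -> U x ->
  exists2 d : R, 0 < d & forall t : R, `|t| < d -> U (x + t *: b).
Proof.
move=> oU Ux; have /nbhs_distP[e e0 eU] : nbhs x U by exact: open_nbhs_nbhs.
have b1 : 0 < `|b| + 1 by rewrite ltr_wpDl.
exists (e / (`|b| + 1)) => [|t]; first by rewrite divr_gt0.
rewrite ltr_pdivlMr// => te; apply: eU; rewrite addrAC subrr add0r normrZ.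
by apply: le_lt_trans te; rewrite ler_wpM2l// lerDl.
Qed.

Lemma local_max_derivatives n (U : set 'rV[R]_n) F D1 D2 x b : open U -> U x ->
  C2_data U F D1 D2 -> (\forall y \near x, F y <= F x) ->
  D1 x b = 0 /\ D2 x b <= 0.
Proof.
move=> oU Ux [FD1 FD2] Fmax.
have /nbhs_distP[e e0 eM] := Fmax.
have oB : open (ball x e) by exact: ball_open.
have [d1 d10 d1U] := line_near b oU Ux.
have [d2 d20 d2B] := line_near b oB (ballxx x e0).
have := @second_derivative_test (fun s => F (x + s *: b))
  (fun s => D1 (x + s *: b) b) (D2 x b) (Num.min d1 d2).
rewrite scale0r addr0; apply; [by rewrite lt_min d10| |exact: FD2].
move=> t; rewrite lt_min => /andP[td1 td2]; split; first exact/FD1/d1U.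
by apply: eM; have := d2B _ td2; rewrite -ball_normE /= distrC.
Qed.

Lemma C2_data_add n U (F D1 D2 : _) (H E1 E2 : _) (e : R) :
  @C2_data n U F D1 D2 -> @C2_data n U H E1 E2 ->
  C2_data U (fun y => F y + e * H y) (fun y b => D1 y b + e * E1 y b)
    (fun y b => D2 y b + e * E2 y b).
Proof.
move=> [F1 F2] [H1 H2]; split=> [x b t Ux|x b Ux].
  have := is_deriveD (F1 _ _ _ Ux) (is_deriveZ e (H1 _ _ _ Ux)).
  exact.
exact: is_deriveD (F2 x b Ux) (is_deriveZ e (H2 x b Ux)).
Qed.

Lemma is_derive_affine n (x b c : 'rV[R]_n) (t : R) :
  is_derive t 1 (fun s : R => x + s *: b - c) b.
Proof.
have E : (fun s : R => x + s *: b - c) = (fun s => s *: b) + cst (x - c).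
  by apply/funext => s /=; rewrite addrAC addrC.
rewrite E -[X in is_derive _ _ _ X]addr0 -[X in X + 0]scale1r.
have bd := is_deriveZrow b (is_derive_id t 1).
exact: is_deriveD bd (is_derive_cst (x - c) t 1).
Qed.

Lemma is_derive_sqdist n (x b c : 'rV[R]_n) (t : R) :
  is_derive t 1 (fun s : R => dotv (x + s *: b - c) (x + s *: b - c))
    (2 * dotv (x + t *: b - c) b).
Proof.
have := is_derive_dotv (is_derive_affine x b c t) (is_derive_affine x b c t).
by rewrite (dotvC b) -mulr2n mulr_natl.
Qed.

Lemma continuous_subr n (y c : 'rV[R]_n) :
  {for y, continuous (fun z : 'rV[R]_n => z - c)}.
Proof.
apply/continuous_mxP => i j.
have -> : (fun z : 'rV[R]_n => (z - c) i j) = (fun z => z i j - c i j).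
  by apply/funext => z; rewrite !mxE.
have yc := @coord_continuous R 1 n i j y.
exact: (cvgB yc (cvg_cst (c i j))).
Qed.

Section Barrier.
Variables (n : nat) (x1 x2 : 'rV[R]_n) (rho beta : R).

Let d (y : 'rV[R]_n) : R := rho - dotv (y - x1) (y - x1).

(* Positive only inside the ball [0 < d] near [x2]; for large [beta] it is a
   strict subsolution at boundary points of that ball. *)
Definition barrier (y : 'rV[R]_n) : R :=
  d y + beta * (d y * d y) - dotv (y - x2) (y - x2).

Definition barrier_D1 (y b : 'rV[R]_n) : R :=
  - 2 * dotv (y - x1) b * (1 + 2 * beta * d y) - 2 * dotv (y - x2) b.

Definition barrier_D2 (y b : 'rV[R]_n) : R :=
  - 2 * dotv b b * (1 + 2 * beta * d y)
  + 8 * beta * (dotv b (y - x1) * dotv b (y - x1)) - 2 * dotv b b.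

Lemma barrier_C2 U : C2_data U barrier barrier_D1 barrier_D2.
Proof.
have dd (x b : 'rV[R]_n) (t : R) :
    is_derive t 1 (fun s => d (x + s *: b)) (0 - 2 * dotv (x + t *: b - x1) b).
  exact: is_deriveB (is_derive_cst rho t 1) (is_derive_sqdist x b x1 t).
have ab (x b c : 'rV[R]_n) (t : R) :
    is_derive t 1 (fun s => dotv (x + s *: b - c) b) (dotv b b + 0).
  have := is_derive_dotv (is_derive_affine x b c t) (is_derive_cst b t 1).
  by rewrite dotv0r.
split=> [x b t _|x b _].
  have d2 := is_deriveZ beta (is_derive_mul (dd x b t) (dd x b t)).
  have := is_deriveB (is_deriveD (dd x b t) d2) (is_derive_sqdist x b x2 t).
  move=> /is_derive_eq; apply; rewrite /barrier_D1 /=.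
  by rewrite /GRing.scale /=; ring.
have s0 : is_derive (0 : R) 1 (fun s => 1 + 2 * beta * d (x + s *: b))
    (0 + (2 * beta) *: (0 - 2 * dotv (x + 0 *: b - x1) b)).
  exact: is_deriveD (is_derive_cst (1 : R) (0 : R) 1)
    (is_deriveZ (2 * beta) (dd x b 0)).
have := is_deriveB (is_derive_mul (is_deriveZ (- 2) (ab x b x1 0)) s0)
  (is_deriveZ 2 (ab x b x2 0)).
move=> /is_derive_eq; apply; rewrite /= !scale0r !addr0 /barrier_D2 /GRing.scale /=.
by rewrite (dotvC b (x - x1)); ring.
Qed.

Lemma barrier_continuous : continuous barrier.
Proof.
move=> y; have sc (c : 'rV[R]_n) : {for y, continuous (fun z : 'rV[R]_n => dotv (z - c) (z - c))}.
  have cc := @continuous_subr _ y c; exact: continuous_dotv.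
have cc (a : R) : {for y, continuous (fun=> a)} by exact: cst_continuous.
have dc : {for y, continuous d} := continuousB (cc rho) (sc x1).
have qc := continuousM (cc beta) (continuousM dc dc).
exact: continuousB (continuousD dc qc) (sc x2).
Qed.

(** A second-order operator with principal part [B^T *m B], applied to the barrier. Written as
    second derivatives along the rows of [B], each summand has a sign at a maximum. *)
Definition barrier_L k (B : 'M[R]_(k, n)) (w : 'rV[R]_n) (y : 'rV[R]_n) : R :=
  \sum_i barrier_D2 y (row i B) - barrier_D1 y w.

(** Where [d y = 0], the only term containing [beta] is [8 * beta] times the value of [a] on
    [y - x1], which ellipticity makes positive. *)
Lemma barrier_LE k (B : 'M[R]_(k, n)) (w y : 'rV[R]_n) (a := B^T *m B) :
  barrier_L B w y = - 2 * \tr a * (1 + 2 * beta * d y)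
  + 8 * beta * dotv ((y - x1) *m a) (y - x1) - 2 * \tr a - barrier_D1 y w.
Proof.
have S1 : \sum_i dotv (row i B) (row i B) = \tr a.
  rewrite /a mxtrace_mulC; apply: eq_bigr => i _.
  by rewrite dotvE tr_row !mxE; apply: eq_bigr => j _; rewrite !mxE.
have S2 v : \sum_i dotv (row i B) v * dotv (row i B) v = dotv (v *m a) v.
  rewrite /a mulmxA dotv_mull /dotv; apply: eq_bigr => i _.
  by congr (_ * _); rewrite mxE; apply: eq_bigr => j _; rewrite !mxE mulrC.
congr (_ - _); rewrite /barrier_D2 sumrB big_split/= -!mulr_suml -!mulr_sumr.
by rewrite S1 S2.
Qed.

End Barrier.

End MaximumPrinciple.

Section StrongMaximum.
Variable R : realType.

Lemma closed_within n (A : set 'rV[R]_n) (P : 'rV[R]_n -> Prop) :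
  closed A -> (forall y, A y -> ~ P y -> \forall z \near y, ~ P z) ->
  closed (A `&` P).
Proof.
move=> cA Pc y yAP; have Ay : A y by apply: cA => B /yAP[z [[Az _] Bz]]; exists z.
split => //; apply: contrapT => /(Pc y Ay) nP.
by have [z [[_ Pz] /(_ Pz)]] := yAP _ nP.
Qed.

Lemma closed_norm_ball n (x : 'rV[R]_n) (r : R) : closed [set y | `|y - x| <= r].
Proof.
have c : continuous (fun y : 'rV[R]_n => `|y - x|).
  move=> y; exact: (continuous_comp (@continuous_subr _ _ y x)
    (@norm_continuous _ _ (y - x))).
exact: (preimage_closed (fun y _ => c y) (@closed_le _ r)).
Qed.

Lemma compact_norm_ball n (x : 'rV[R]_n) (r : R) : compact [set y | `|y - x| <= r].
Proof.
apply: bounded_closed_compact.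
  exists (`|x| + r); split => [|M xM y /= yr]; first by rewrite num_real.
  apply: le_trans (ltW xM); rewrite -[y](subrK x) addrC.
  by apply: le_trans (ler_normD _ _) _; rewrite addrC [leRHS]addrC lerD2r.
exact: closed_norm_ball.
Qed.

Lemma compact_within_norm_ball n (x : 'rV[R]_n) (r : R) (P : 'rV[R]_n -> Prop) :
  (forall y, `|y - x| <= r -> ~ P y -> \forall z \near y, ~ P z) ->
  compact ([set y | `|y - x| <= r] `&` P).
Proof.
move=> Pc; apply: (subclosed_compact _ (@compact_norm_ball n x r)).
  by apply: closed_within => //; exact: closed_norm_ball.
by move=> y [].
Qed.

Lemma compact_argmax (T : topologicalType) (A : set T) (F : T -> R) :
  A !=set0 -> compact A -> (forall y, A y -> {for y, continuous F}) ->
  exists2 c, A c & forall y, A y -> F y <= F c.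
Proof.
move=> A0 cA Fc; have [|c cA' cM] := compact_EVT_max A0 cA (f := F).
  apply: continuous_in_subspaceT => y; rewrite inE; exact: Fc.
by exists c => [|y Ay]; [rewrite inE in cA'|apply: cM; rewrite inE].
Qed.

(** Neighbourhoods are measured in the sup norm, touching balls in the Euclidean one; this lemma and
    the next one compare the two. *)
Lemma sqr_norm_le_dotv n (v : 'rV[R]_n) : `|v| ^+ 2 <= dotv v v.
Proof.
have s0 : 0 <= Num.sqrt (dotv v v) by exact: sqrtr_ge0.
rewrite -(sqr_sqrtr (dotv_ge0 v)) ler_sqr ?nnegrE//.
apply: norm_le_coord => // i; rewrite -sqrtr_sqr ler_wsqrtr//.
exact: sqr_coord_le_dotv.
Qed.

Lemma dotv_le_sqr_norm n (v : 'rV[R]_n) : dotv v v <= n%:R * `|v| ^+ 2.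
Proof.
apply: (@le_trans _ _ (\sum_(i < n) `|v| ^+ 2)).
  apply: ler_sum => i _; rewrite -expr2 -real_normK ?num_real//.
  by rewrite ler_sqr ?nnegrE// coord_le_norm.
by rewrite sumr_const card_ord mulr_natl.
Qed.

End StrongMaximum.

(** * Hopf's barrier argument for elliptic subsolutions *)

Section Hopf.
Variables (R : realType) (n k : nat) (U : set 'rV[R]_n) (F : 'rV[R]_n -> R).
Variables (D1 D2 : 'rV[R]_n -> 'rV[R]_n -> R).
Variables (B : 'rV[R]_n -> 'M[R]_(k, n)) (w : 'rV[R]_n -> 'rV[R]_n).
Hypotheses (oU : open U) (FC2 : C2_data U F D1 D2).
Hypothesis Fc : forall x, U x -> {for x, continuous F}.
Hypothesis Bc : forall x, U x -> {for x, continuous B}.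
Hypothesis wc : forall x, U x -> {for x, continuous w}.
Hypothesis ell : forall x v, U x -> v != 0 ->
  0 < dotv (v *m ((B x)^T *m B x)) v.
Hypothesis FL : forall x, U x -> 0 <= \sum_i D2 x (row i (B x)) - D1 x (w x).

Lemma barrier_L_le0 x1 x2 rho beta (e : R) c : 0 < e -> U c ->
  (\forall y \near c, F y + e * barrier x1 x2 rho beta y <=
     F c + e * barrier x1 x2 rho beta c) ->
  barrier_L x1 x2 rho beta (B c) (w c) c <= 0.
Proof.
move=> e0 Uc cmax.
have GC2 := C2_data_add e FC2 (@barrier_C2 _ _ x1 x2 rho beta U).
have test b := local_max_derivatives b oU Uc GC2 cmax.
have sum_le0 : \sum_i D2 c (row i (B c)) +
    e * \sum_i barrier_D2 x1 rho beta c (row i (B c)) <= 0.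
  rewrite mulr_sumr -big_split/=; apply: sumr_le0 => i _.
  exact: (test _).2.
have [/= w0 _] := test (w c).
have := FL Uc; rewrite /barrier_L => FL0.
rewrite -(pmulr_rle0 _ e0) mulrBr; lra.
Qed.

Lemma barrier_L_continuous x1 x2 rho beta x : U x ->
  {for x, continuous (fun y => barrier_L x1 x2 rho beta (B y) (w y) y)}.
Proof.
move=> Ux; pose a y := (B y)^T *m B y.
have ac : {for x, continuous a}.
  by apply: continuous_mulmx; [apply: continuous_tr|]; exact: Bc.
have -> : (fun y => barrier_L x1 x2 rho beta (B y) (w y) y) = (fun y =>
    - 2 * \tr (a y) * (1 + 2 * beta * (rho - dotv (y - x1) (y - x1)))
    + 8 * beta * dotv ((y - x1) *m a y) (y - x1) - 2 * \tr (a y)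
    - (- 2 * dotv (y - x1) (w y) *
        (1 + 2 * beta * (rho - dotv (y - x1) (y - x1))) - 2 * dotv (y - x2) (w y))).
  by apply/funext => y; rewrite barrier_LE.
have cc (c : R) : {for x, continuous (fun=> c)} by exact: cst_continuous.
have sc c : {for x, continuous (fun y : 'rV[R]_n => y - c)} :=
  @continuous_subr _ _ x c.
have trc := continuous_trace ac.
have qc := continuousD (cc 1) (continuousM (cc (2 * beta))
  (continuousB (cc rho) (continuous_dotv (sc x1) (sc x1)))).
have ec := continuousM (cc (8 * beta))
  (continuous_dotv (continuous_mulmx (sc x1) ac) (sc x1)).
have dc c := continuous_dotv (sc c) (wc Ux).
have t1 := continuousD (continuousM (continuousM (cc (- 2)) trc) qc) ec.
have t2 := continuousB t1 (continuousM (cc 2) trc).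
have t3 := continuousB (continuousM (continuousM (cc (- 2)) (dc x1)) qc)
  (continuousM (cc 2) (dc x2)).
exact: continuousB t2 t3.
Qed.

(** Take [x1] near [x0] outside the maximum set and [x2] a point of that set nearest to [x1]: the
    Euclidean ball around [x1] through [x2] then misses the maximum set near [x2]. *)
Lemma interior_touching x0 : U x0 -> (forall x, U x -> F x <= F x0) ->
  ~ (\forall x \near x0, F x = F x0) ->
  exists x1 x2 (r : R), [/\ 0 < r, x1 != x2, F x2 = F x0,
    forall y, `|y - x2| < r -> U y
    & forall y, `|y - x2| < r ->
      dotv (y - x1) (y - x1) < dotv (x2 - x1) (x2 - x1) -> F y < F x0].
Proof.
move=> Ux0 Fmax nF.
have /nbhs_distP[r0 r00 r0U] : nbhs x0 U by exact: open_nbhs_nbhs.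
pose r := r0 / 2; have rpos : 0 < r by rewrite divr_gt0.
have rU y : `|y - x0| <= r -> U y.
  move=> yr; apply: r0U; apply: le_lt_trans yr _.
  by rewrite ltr_pdivrMr// ltr_pMr// ltr1n.
(* Passing from the Euclidean to the sup norm costs a factor at most [n], so [x2] is within [n d] of
   [x1] and [x1] within [d] of [x0]. Since [r = (n + 2) d], [x2] falls strictly inside the norm ball
   of radius [r]. *)
pose d := r / n.+2%:R; have d0 : 0 < d by rewrite divr_gt0.
have rE : r = n%:R * d + 2 * d.
  by rewrite -mulrDl -natrD addn2 /d mulrC divfK// pnatr_eq0.
have [x1 [x1d Fx1]] : exists x1, `|x1 - x0| < d /\ F x1 != F x0.
  apply: contrapT => nx; apply: nF; apply: (nbhs_distP _ _).2.
  exists d => // y yd; apply/eqP/negP => /negP Fy; apply: nx.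
  by exists y.
pose K := [set y | `|y - x0| <= r] `&` [set y | F y = F x0].
have Kc : compact K.
  apply: compact_within_norm_ball => y /rU Uy /= /eqP Fy.
  have : F y - F x0 != 0 by rewrite subr_eq0.
  have yc : {for y, continuous (fun z => F z - F x0)}.
    by apply: (continuousB (Fc Uy)); exact: cst_continuous.
  move=> /(cvgr_neq0 _ yc); apply: filterS => z /eqP + E; apply.
  by rewrite /= E subrr.
have Kx0 : K x0 by split => //=; rewrite subrr normr0 ltW.
pose N y := dotv (y - x1) (y - x1).
have [x2 [/= x2r Fx2] x2min] : exists2 c, K c & forall y, K y -> - N y <= - N c.
  apply: (@compact_argmax _ _ K (fun y => - N y)) => //; first by exists x0.
  move=> y _; apply: continuousN.
  by apply: continuous_dotv; exact: continuous_subr.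
have x12 : x1 != x2 by apply: contraNneq Fx1 => ->; rewrite Fx2.
have x2d : `|x2 - x0| < r.
  have : `|x2 - x1| ^+ 2 <= (n%:R * d) ^+ 2.
    apply: le_trans (sqr_norm_le_dotv _) _.
    have := x2min _ Kx0; rewrite lerN2 => /le_trans; apply.
    apply: le_trans (dotv_le_sqr_norm _) _; rewrite exprMn.
    apply: ler_pM => //.
      by rewrite expr2 -natrM ler_nat; case: (n) => // p; rewrite leq_pmulr.
    by rewrite ler_sqr ?nnegrE ?(ltW d0)// distrC ltW.
  have nd0 : 0 <= n%:R * d by rewrite mulr_ge0// ltW.
  rewrite ler_sqr ?nnegrE// => x21.
  rewrite -(subrKA x1); apply: le_lt_trans (ler_normD _ _) _.
  by rewrite rE; lra.
exists x1, x2, (r - `|x2 - x0|).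
have inr y : `|y - x2| < r - `|x2 - x0| -> `|y - x0| <= r.
  move=> yr; rewrite -(subrKA x2); apply: le_trans (ler_normD _ _) _; lra.
split => // [|y /inr/rU//|y /inr yr yN]; first by rewrite subr_gt0.
rewrite lt_def Fmax ?andbT; last exact: rU.
apply/eqP => /esym Fy; have := x2min y (conj yr Fy).
by rewrite lerN2 leNgt yN.
Qed.

(** On a small norm ball [S] around the touching point [x2], maximise [F + e h], whose value at [x2]
    is [F x0]. On the boundary of [S], either [h < 0], or [F] is strictly below its maximum and a
    small [e] keeps the sum below. So the maximum can be taken at an interior point, where
    positivity of the operator on [h] contradicts [barrier_L_le0]. *)
Theorem strong_maximum x0 : U x0 -> (forall x, U x -> F x <= F x0) ->
  \forall x \near x0, F x = F x0.
Proof.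
move=> Ux0 Fmax; apply: contrapT => nF.
have [x1 [x2 [r [r0 x12 Fx2 rU inside]]]] := interior_touching Ux0 Fmax nF.
have Ux2 : U x2 by apply: rU; rewrite subrr normr0.
pose rho := dotv (x2 - x1) (x2 - x1).
pose a := (B x2)^T *m B x2.
have q0 : 0 < dotv ((x2 - x1) *m a) (x2 - x1).
  by apply: ell => //; rewrite subr_eq0 eq_sym.
set q := dotv _ _ in q0.
(* At [x2] the operator applied to the barrier equals [8 * beta * q + C]; the chosen [beta] turns
   this into [|C| + 1 + C > 0]. *)
pose C := - 4 * \tr a + 2 * dotv (x2 - x1) (w x2).
pose beta := (`|C| + 1) / (8 * q).
have L0 : 0 < barrier_L x1 x2 rho beta (B x2) (w x2) x2.
  rewrite barrier_LE /barrier_D1 -/a -/q -/rho !subrr mulr0 addr0 dotv0l mulr0 subr0 !mulr1.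
  have -> : 8 * beta * q = `|C| + 1.
    by rewrite /beta; field; rewrite gt_eqF.
  by have : - C <= `|C| by [rewrite -normrN ler_norm]; rewrite /C; lra.
have /nbhs_distP[r1 r10 r1L] :
    \forall y \near x2, 0 < barrier_L x1 x2 rho beta (B y) (w y) y.
  exact: cvgr_gt _ (@barrier_L_continuous x1 x2 rho beta x2 Ux2) _ L0.
pose h := barrier x1 x2 rho beta; pose D y := rho - dotv (y - x1) (y - x1).
have hc : continuous h := @barrier_continuous _ _ _ _ _ _.
have hx2 : h x2 = 0.
  by rewrite /h /barrier -/rho !subrr mulr0 mulr0 addr0 dotv0l subrr.
have Dc y : {for y, continuous (fun y => 1 + beta * D y)}.
  have cc (c : R) : {for y, continuous (fun=> c)} by exact: cst_continuous.
  apply: (continuousD (cc 1)); apply: (continuousM (cc beta)).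
  apply: (continuousB (cc rho)).
  by apply: continuous_dotv; exact: continuous_subr.
have Dx2 : 0 < 1 + beta * D x2 by rewrite /D -/rho subrr mulr0 addr0.
have /nbhs_distP[r2 r20 r2D] : \forall y \near x2, 0 < 1 + beta * D y.
  exact: cvgr_gt _ (Dc x2) _ Dx2.
pose s := Num.min r (Num.min r1 r2) / 2.
have m0 : 0 < Num.min r (Num.min r1 r2) by rewrite !lt_min r0 r10.
have s0 : 0 < s by rewrite divr_gt0.
have : s < Num.min r (Num.min r1 r2) by rewrite ltr_pdivrMr// ltr_pMr// ltr1n.
rewrite !lt_min => /and3P[sr sr1 sr2].
pose S := [set y : 'rV[R]_n | `|y - x2| <= s].
have SU y : S y -> U y by move=> Sy; apply: rU; exact: le_lt_trans sr.
have Sx2 : S x2 by rewrite /S /= subrr normr0 ltW.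
have Sc : compact S := @compact_norm_ball _ _ x2 s.
(* Outside the Euclidean ball [D y <= 0]; as [1 + beta * D y] is still positive,
   [D y * (1 + beta * D y) <= 0], and subtracting [|y - x2|^2] makes [h y] negative. *)
have outside y : `|y - x2| = s -> 0 <= h y -> F y < F x0.
  move=> ys hy; apply: inside; first by rewrite ys.
  rewrite ltNge; apply/negP => rhoy.
  have D0 : D y <= 0 by rewrite subr_le0.
  have : 0 < 1 + beta * D y by apply: r2D; rewrite ys.
  move=> /ltW D1y; have : D y * (1 + beta * D y) <= 0 by exact: mulr_le0_ge0.
  have : 0 < dotv (y - x2) (y - x2).
    by apply: dotv_gt0; rewrite -normr_gt0 ys.
  by move: hy; rewrite /h /barrier -/(D y); nra.
have [e [e0 eS]] : exists e : R, 0 < e /\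
    forall y, `|y - x2| = s -> 0 <= h y -> F y + e * h y < F x0.
  pose E := S `&` [set y | `|y - x2| = s /\ 0 <= h y].
  have [E0|nE] := pselect (E !=set0); last first.
    exists 1; split=> // y ys hy; exfalso; apply: nE; exists y.
    by split=> //; rewrite /S /= ys.
  have Ec : compact E.
    apply: compact_within_norm_ball => y _ /= /not_andP[ys|/negP hy].
      have yc : {for y, continuous (fun z : 'rV[R]_n => `|z - x2| - s)}.
        apply: continuousB; last exact: cst_continuous.
        exact: (continuous_comp (@continuous_subr _ _ y x2)
          (@norm_continuous _ _ (y - x2))).
      have : `|y - x2| - s != 0 by rewrite subr_eq0; apply/eqP.
      move=> /(cvgr_neq0 _ yc); apply: filterS => z /eqP + [zs _]; apply.
      by rewrite /= zs subrr.
    move: hy; rewrite -ltNge => /(cvgr_lt _ (hc y) _); apply: filterS => z hz [_].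
    by rewrite leNgt hz.
  have [c [Sc1 [cs hc0]] cmax] : exists2 c, E c & forall y, E y -> F y <= F c.
    by apply: (@compact_argmax _ _ E F) => // y [/SU/Fc].
  have [m Sm mmax] : exists2 m, S m & forall y, S y -> h y <= h m.
    by apply: (@compact_argmax _ _ S h) => // [|y _]; [exists x2|exact: hc].
  have hm0 : 0 <= h m by rewrite -hx2 mmax.
  have Fcx : 0 < F x0 - F c by rewrite subr_gt0 outside.
  (* [F c] is the largest value of [F] on the dangerous part of the boundary and [h m] the largest
     value of [h] on [S]; adding 1 keeps the denominator positive. *)
  exists ((F x0 - F c) / (h m + 1)); split; first by rewrite divr_gt0// ltr_wpDl.
  move=> y ys hy; have Sy : S y by rewrite /S /= ys.
  apply: (@le_lt_trans _ _ (F c + (F x0 - F c) / (h m + 1) * h y)).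
    by rewrite lerD2r cmax.
  rewrite -ltrBrDl mulrAC ltr_pdivrMr ?ltr_wpDl// ltr_pM2l//.
  by apply: le_lt_trans (mmax _ Sy) _; rewrite ltrDl.
have [c Sc1 cmax] : exists2 c, S c & forall y, S y -> F y + e * h y <= F c + e * h c.
  apply: (@compact_argmax _ _ S (fun y => F y + e * h y)) => //; first by exists x2.
  move=> y /SU/Fc Fy; apply: (continuousD Fy).
  by apply: continuousM; [exact: cst_continuous|exact: hc].
have cx2 : F x0 <= F c + e * h c by rewrite -Fx2 -[F x2]addr0 -(mulr0 e) -hx2 cmax.
have [cs|cs] := eqVneq (`|c - x2|) s.
  have [hc0|hc0] := leP 0 (h c).
    by have := eS c cs hc0; rewrite ltNge cx2.
  have := Fmax c (SU _ Sc1); rewrite leNgt => /negP; apply.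
  by apply: le_lt_trans cx2 _; rewrite gtrDl pmulr_rlt0.
have cs' : `|c - x2| < s by rewrite lt_neqAle cs.
have : barrier_L x1 x2 rho beta (B c) (w c) c <= 0.
  apply: (barrier_L_le0 e0 (SU _ Sc1)).
  apply: (nbhs_distP _ _).2; exists (s - `|c - x2|); first by rewrite subr_gt0.
  move=> y yc; apply: cmax; rewrite /S /= -(subrKA c).
  by apply: le_trans (ler_normD _ _) _; lra.
by rewrite leNgt => /negP; apply; apply: r1L; exact: lt_trans sr1.
Qed.

End Hopf.

(** * Extrinsic geometry of a parametrization *)

Section LocalGeometry.
Variables (R : realType) (n m : nat) (U : set 'rV[R]_n).
Variable f : 'rV[R]_n -> 'rV[R]_m.
Hypotheses (oU : open U) (fC2 : Ck 2 U f).
Hypothesis finj : forall x, U x -> injective ('d f x).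

Definition grad p (h : 'rV[R]_n -> 'rV[R]_p) (x : 'rV[R]_n) : 'M[R]_(n, p) :=
  \matrix_(i < n) partial i h x.

Let fC1 : Ck 1 U f.
Proof. by have [fc fd fp] := fC2; split=> // i; have [] := fp i. Qed.

Lemma grad_jacobian x : U x -> grad f x = 'J f x.
Proof.
move=> Ux; apply/row_matrixP => i; rewrite rowK row_jacobian//.
exact: C1_differentiable Ux.
Qed.

Lemma diffE_grad x v : U x -> 'd f x v = v *m grad f x.
Proof. by move=> Ux; rewrite grad_jacobian// /jacobian mul_rV_lin1. Qed.

Lemma grad_free x : U x -> row_free (grad f x).
Proof.
move=> Ux; apply: inj_row_free => v; rewrite -diffE_grad// => v0.
by apply: (finj Ux); rewrite v0 linear0.
Qed.

Lemma first_formE x : first_form f x = grad f x *m (grad f x)^T.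
Proof.
apply/matrixP => i j; rewrite !mxE /dotv; apply: eq_bigr => k _.
by rewrite !mxE.
Qed.

Lemma normal_partE x v : U x -> normal_part f x v = v - v *m tproj (grad f x).
Proof.
by move=> Ux; rewrite /normal_part -grad_jacobian// normal_proj// grad_free.
Qed.

(** The metric trace of the plain second derivatives. Its normal part is the mean curvature; its
    tangential part is the Christoffel term of the Laplacian. *)
Definition unnormalized_mean x : 'rV[R]_m :=
  \sum_i \sum_j invmx (first_form f x) i j *: partial i (partial j f) x.

Lemma mean_curvatureE x : U x -> mean_curvature f x =
  unnormalized_mean x - unnormalized_mean x *m tproj (grad f x).
Proof.
move=> Ux; rewrite /mean_curvature /unnormalized_mean.
rewrite mulmx_suml -sumrB; apply: eq_bigr => i _.
rewrite mulmx_suml -sumrB; apply: eq_bigr => j _.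
by rewrite /second_form normal_partE// -scalemxAl scalerBr.
Qed.

(** The second derivative of [f] along the line of direction [b]. *)
Definition hess x (b : 'rV[R]_n) : 'rV[R]_m :=
  \sum_j b 0 j *: (b *m grad (partial j f) x).

Lemma line_derive p (h : 'rV[R]_n -> 'rV[R]_p) x b (t : R) : Ck 1 U h ->
  U (x + t *: b) ->
  is_derive t 1 (fun s => h (x + s *: b)) (b *m grad h (x + t *: b)).
Proof.
move=> hC1 Ux; have hd := C1_differentiable oU hC1 Ux.
have -> : grad h (x + t *: b) = 'J h (x + t *: b).
  by apply/row_matrixP => i; rewrite rowK row_jacobian.
have [hv <-] := approx_derive b hd; exact: is_derive_line.
Qed.

Lemma grad_line_derive x b : U x ->
  is_derive (0 : R) 1 (fun s => b *m grad f (x + s *: b)) (hess x b).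
Proof.
move=> Ux; have -> : (fun s : R => b *m grad f (x + s *: b)) =
    (fun s => \sum_j b 0 j *: partial j f (x + s *: b)).
  by apply/funext => s; rewrite mulmx_sum_row; apply: eq_bigr => j _; rewrite rowK.
have jd j : is_derive (0 : R) 1 (fun s => b 0 j *: partial j f (x + s *: b))
    (b 0 j *: (b *m grad (partial j f) x)).
  apply: is_deriveZ; have [_ _ fp] := fC2.
  have := @line_derive _ (partial j f) x b 0 (fp j).
  by rewrite scale0r addr0; apply.
have := is_derive_sum jd; rewrite fct_sumE; exact.
Qed.

Lemma grad_continuous x : U x -> {for x, continuous (grad f)}.
Proof.
move=> Ux; apply/continuous_mxP => i j.
have -> : (fun y => grad f y i j) = (fun y => partial i f y 0 j).
  by apply/funext => y; rewrite mxE.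
by have [_ _ fp] := fC1; have /continuous_mxP := fp i x Ux.
Qed.

Lemma first_form_continuous x : U x -> {for x, continuous (first_form f)}.
Proof.
move=> Ux; have -> : first_form f = (fun y => grad f y *m (grad f y)^T).
  by apply/funext => y; rewrite first_formE.
apply: continuous_mulmx; first exact: grad_continuous.
exact/continuous_tr/grad_continuous.
Qed.

Lemma first_form_unit x : U x -> first_form f x \in unitmx.
Proof. by move=> Ux; rewrite first_formE gram_unit// grad_free. Qed.

Lemma unnormalized_mean_continuous x : U x ->
  {for x, continuous unnormalized_mean}.
Proof.
move=> Ux; apply/continuous_mxP => k l; rewrite (ord1 k).
have -> : (fun y => unnormalized_mean y 0 l) = (fun y => \sum_i \sum_j
    invmx (first_form f y) i j * partial i (partial j f) y 0 l).
  apply/funext => y; rewrite summxE; apply: eq_bigr => i _.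
  by rewrite summxE; apply: eq_bigr => j _; rewrite mxE.
have gc := continuous_invmx (first_form_unit Ux) (first_form_continuous Ux).
apply: continuous_sumr => i; apply: continuous_sumr => j.
apply: continuousM; first by move/continuous_mxP: gc.
have [_ _ fp] := fC2; have [_ _ fpp] := fp j.
by have /continuous_mxP := fpp i x Ux.
Qed.

Section QuadraticForm.
Variable S : 'M[R]_m.
Hypothesis symS : S^T = S.

Definition quad x : R := dotv (f x *m S) (f x).
Definition quad_D1 x (b : 'rV[R]_n) : R :=
  2 * dotv (f x *m S) (b *m grad f x).
Definition quad_D2 x (b : 'rV[R]_n) : R :=
  2 * dotv (b *m grad f x *m S) (b *m grad f x) + 2 * dotv (f x *m S) (hess x b).

Lemma quad_C2 : C2_data U quad quad_D1 quad_D2.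
Proof.
split=> [x b t Ux|x b Ux].
  have fl := line_derive fC1 Ux.
  have := is_derive_dotv (is_derive_mulmxr S fl) fl.
  move/is_derive_eq; apply; rewrite dotv_mull symS dotvC /quad_D1; lra.
have := @line_derive _ f x b 0 fC1; rewrite scale0r addr0 => /(_ Ux) fl.
have := is_deriveZ 2 (is_derive_dotv (is_derive_mulmxr S fl) (grad_line_derive b Ux)).
move/is_derive_eq; apply; rewrite /quad_D2 scale0r addr0 -mulrDr.
by [].
Qed.

Lemma quad_continuous x : U x -> {for x, continuous quad}.
Proof.
move=> Ux; have fc : {for x, continuous f} by have [fc _ _] := fC2; exact: fc.
have Sc : {for x, continuous (fun _ : 'rV[R]_n => S)} by exact: cst_continuous.
exact: continuous_dotv (continuous_mulmx fc Sc) fc.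
Qed.

(** Row [k] holds the coordinates of the tangential projection of the [k]-th standard vector of R^m.
    These [m] vectors replace an orthonormal tangent frame: they have Gram matrix [g^-1] in the
    sense of [frame_gram] and depend continuously on [x]. *)
Definition frame x : 'M[R]_(m, n) := (grad f x)^T *m invmx (first_form f x).
(** Coordinates of the tangential part of [unnormalized_mean]. *)
Definition drift x : 'rV[R]_n :=
  unnormalized_mean x *m (grad f x)^T *m invmx (first_form f x).

Lemma frame_gram x : U x -> (frame x)^T *m frame x = invmx (first_form f x).
Proof.
move=> Ux; rewrite /frame trmx_mul trmxK trmx_inv.
have -> : (first_form f x)^T = first_form f x.
  by rewrite first_formE trmx_mul trmxK.
rewrite !mulmxA -(mulmxA _ (grad f x)) -first_formE mulVmx ?mul1mx//.
exact: first_form_unit.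
Qed.

(* The operator [sum_k D2 (row k frame) - D1 drift] is the Laplacian of the
   induced metric, since the Hessian of [f] has trace [H] up to a tangential
   term; applied to [quad] it only involves [H] and the tangent space. *)
Lemma quad_laplacian x : U x ->
  \sum_k quad_D2 x (row k (frame x)) - quad_D1 x (drift x) =
  2 * dotv (f x *m S) (mean_curvature f x) + 2 * \tr (S *m tproj (grad f x)).
Proof.
move=> Ux; set T := tproj (grad f x); set tau := unnormalized_mean x.
have FT : frame x *m grad f x = T by rewrite /frame first_formE.
have dT : drift x *m grad f x = tau *m T.
  by rewrite /drift -!mulmxA -FT /frame !mulmxA.
have TT : T *m T = T.
  by rewrite {1}/T /tproj -mulmxA mulmx_tproj ?grad_free.
have S1 : \sum_k dotv (row k (frame x) *m grad f x *m S)
    (row k (frame x) *m grad f x) = \tr (S *m T).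
  have -> : \tr (S *m T) = \tr (T *m S *m T).
    by rewrite -{1}TT mulmxA mxtrace_mulC mulmxA.
  apply: eq_bigr => k _; rewrite -!row_mul FT /dotv [RHS]mxE.
  have Tjk j : T j k = T k j by rewrite /T -[in LHS](tproj_sym (grad f x)) mxE.
  by apply: eq_bigr => j _; rewrite Tjk; congr (_ * _); rewrite mxE.
(* By [frame_gram], summing a bilinear expression over the rows of the frame contracts it with the
   inverse metric. *)
have S2 : \sum_k hess x (row k (frame x)) = tau.
  rewrite /hess exchange_big /tau /unnormalized_mean [RHS]exchange_big /=.
  apply: eq_bigr => j _.
  under eq_bigr => k _ do rewrite mulmx_sum_row scaler_sumr.
  rewrite exchange_big; apply: eq_bigr => i _ /=.
  under eq_bigr => k _ do rewrite scalerA rowK.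
  rewrite -scaler_suml -frame_gram// mxE; congr (_ *: _).
  by apply: eq_bigr => k _; rewrite !mxE mulrC.
rewrite big_split/= -!mulr_sumr S1.
have -> : \sum_i dotv (f x *m S) (hess x (row i (frame x))) = dotv (f x *m S) tau.
  by rewrite -S2 dotvC dotv_suml; apply: eq_bigr => i _; rewrite dotvC.
rewrite /quad_D1 dT mean_curvatureE// -/T -/tau dotvBr; lra.
Qed.

End QuadraticForm.
End LocalGeometry.

(** * Rotations through the Cayley transform *)

Section Cayley.
Variable R : realType.

Lemma skew_dotv n (X : 'M[R]_n) v : X^T = - X -> dotv (v *m X) v = 0.
Proof.
move=> sX; have : dotv (v *m X) v = - dotv (v *m X) v.
  by rewrite {1}dotv_mull sX mulmxN dotvNr dotvC.
by move=> ?; lra.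
Qed.

Lemma skew_sub_unit n (X : 'M[R]_n) : X^T = - X -> 1%:M - X \in unitmx.
Proof.
move=> sX; rewrite -row_free_unit; apply: inj_row_free => v.
rewrite mulmxBr mulmx1 => /eqP; rewrite subr_eq0 => /eqP vX.
by apply/eqP; rewrite -dotv_eq0 {1}vX skew_dotv.
Qed.

(** A rational substitute for the exponential: for skew [Y], [s |-> cayley (s *: Y)] is a curve in
    SO(n) through the identity with velocity [2 Y]. *)
Definition cayley n (X : 'M[R]_n) : 'M[R]_n := (1%:M + X) *m invmx (1%:M - X).

Lemma cayleyK n (X : 'M[R]_n) : X^T = - X -> cayley X *m (1%:M - X) = 1%:M + X.
Proof. by move=> /skew_sub_unit uX; rewrite /cayley -mulmxA mulVmx// mulmx1. Qed.

Lemma cayley_uniq n (X K : 'M[R]_n) : X^T = - X ->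
  K *m (1%:M - X) = 1%:M + X -> K = cayley X.
Proof. by move=> /skew_sub_unit uX KX; rewrite /cayley -KX -mulmxA mulmxV// mulmx1. Qed.

(** [1 + X] and [1 - X] commute and are transposes of each other, hence also have the same
    determinant. *)
Lemma cayley_special n (X : 'M[R]_n) : X^T = - X -> specialO (cayley X).
Proof.
move=> sX; have uX := skew_sub_unit sX.
have trX : (1%:M - X)^T = 1%:M + X by rewrite linearB/= trmx1 sX opprK.
have trX' : (1%:M + X)^T = 1%:M - X by rewrite -trX trmxK.
have uX' : 1%:M + X \in unitmx by rewrite -trX unitmx_tr.
split; last first.
  by rewrite /cayley det_mulmx det_inv -trX det_tr mulrV// -unitmxE.
have comm : (1%:M - X) *m (1%:M + X) = (1%:M + X) *m (1%:M - X).
  rewrite mulmxDr mulmxBr !mulmxBl !mulmxDl !mul1mx !mulmx1.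
  by rewrite opprD !addrA subrK addrK.
have cE : cayley X = invmx (1%:M - X) *m (1%:M + X).
  by rewrite -[RHS](mulmxK uX) -[X in _ = X *m _]mulmxA -comm mulmxA mulVmx// mul1mx.
rewrite {1}cE /cayley trmx_mul trmx_inv trX trX' -mulmxA [X in _ *m X]mulmxA.
by rewrite mulmxV// mul1mx mulVmx.
Qed.

Lemma specialOM n (A B : 'M[R]_n) : specialO A -> specialO B -> specialO (A *m B).
Proof.
move=> [AA dA] [BB dB]; split; last by rewrite det_mulmx dA dB mulr1.
by rewrite trmx_mul mulmxA -(mulmxA A) BB mulmx1.
Qed.

(** [u *m cayley X = v] amounts to [(u + v) *m X = v - u]. Equal lengths make [u + v] orthogonal to
    [v - u], so a skew matrix of rank at most two in their span solves this. *)
Lemma cayley_transport n (u v : 'rV[R]_n) : dotv u u = dotv v v -> u + v != 0 ->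
  exists2 B, specialO B & u *m B = v.
Proof.
move=> uv uv0; pose p := u + v; pose q := v - u.
pose X := (dotv p p)^-1 *: (p^T *m q - q^T *m p).
have pp0 : dotv p p != 0 by rewrite dotv_eq0.
have sX : X^T = - X.
  by rewrite /X linearZ linearB/= !trmx_mul !trmxK -scalerN opprB.
have sc (a b : 'rV[R]_n) : a *m b^T = (dotv a b)%:M.
  by rewrite dotvE -mx11_scalar.
have pq : dotv p q = 0 by rewrite dotvDl !dotvBr uv (dotvC v u); lra.
have pX : p *m X = q.
  rewrite /X -scalemxAr mulmxBr !mulmxA !sc pq mul_scalar_mx mul_scalar_mx.
  by rewrite scale0r subr0 scalerA mulVf// scale1r.
exists (cayley X); first exact: cayley_special.
rewrite /cayley mulmxA; have -> : u *m (1%:M + X) = v *m (1%:M - X).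
  rewrite mulmxDr mulmxBr !mulmx1; apply/eqP; rewrite -subr_eq0 opprB.
  by rewrite [u + _]addrC addrACA -mulmxDl -/p pX /q -opprB addNr.
by rewrite mulmxK// skew_sub_unit.
Qed.

Lemma specialO_transitive n (u v : 'rV[R]_n) : (2 <= n)%N ->
  dotv u u = 1 -> dotv v v = 1 -> exists2 B, specialO B & u *m B = v.
Proof.
case: n u v => [|[|n]]// u v _ uu vv.
have [uv|uv] := eqVneq (u + v) 0; last by apply: cayley_transport => //; rewrite uu.
have dd (i : 'I_n.+2) : dotv (delta_mx 0 i : 'rV[R]_n.+2) (delta_mx 0 i) = 1.
  by rewrite dotv_delta mxE !eqxx.
(* When [v = -u], pass through a unit vector [w] other than [u] and [-u]: the first basis vector, or
   the second if the first coordinate of [u] has square 1. *)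
have [w [ww uw wv]] : exists w : 'rV[R]_n.+2,
    [/\ dotv w w = 1, u + w != 0 & w + v != 0].
  have vE : v = - u by apply/eqP; rewrite -addr_eq0 addrC uv.
  have [u0|u0] := eqVneq (u 0 0 * u 0 0) 1; last first.
    exists (delta_mx 0 0); split => //.
      apply: contra_neq u0 => /rowP/(_ 0); rewrite !mxE /= => h.
      have -> : u 0 0 = - 1 by apply/eqP; rewrite -addr_eq0 h.
      by rewrite mulrNN mulr1.
    apply: contra_neq u0 => /rowP/(_ 0); rewrite vE !mxE /= => h.
    have -> : u 0 0 = 1 by apply/eqP; rewrite eq_sym -subr_eq0 h.
    by rewrite mulr1.
  exists (delta_mx 0 1); split => //.
    apply: contra_eq_neq u0 => /rowP/(_ 0); rewrite !mxE /= addr0 => ->.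
    by rewrite mul0r eq_sym oner_eq0.
  apply: contra_eq_neq u0 => /rowP/(_ 0); rewrite vE !mxE /= add0r => /eqP.
  by rewrite oppr_eq0 => /eqP ->; rewrite mul0r eq_sym oner_eq0.
have [B1 SB1 uB1] : exists2 B, specialO B & u *m B = w.
  by apply: cayley_transport => //; rewrite uu.
have [B2 SB2 wB2] : exists2 B, specialO B & w *m B = v.
  by apply: cayley_transport => //; rewrite ww.
by exists (B1 *m B2); [exact: specialOM|rewrite mulmxA uB1].
Qed.

(** A real matrix acting on C^n, in the coordinates (Re z, Im z). *)
Definition dbl n (X : 'M[R]_n) : 'M[R]_(n + n) := block_mx X 0 0 X.

Lemma dbl_skew n (X : 'M[R]_n) : X^T = - X -> (dbl X)^T = - dbl X.
Proof. by move=> sX; rewrite /dbl tr_block_mx !trmx0 sX opp_block_mx oppr0. Qed.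

Lemma dbl_cayley n (X : 'M[R]_n) : X^T = - X -> dbl (cayley X) = cayley (dbl X).
Proof.
move=> sX; apply: cayley_uniq; first exact: dbl_skew.
rewrite /dbl (@scalar_mx_block _ n n) opp_block_mx !add_block_mx !oppr0 !addr0.
by rewrite mulmx_block !mulmx0 !mul0mx !addr0 !add0r cayleyK.
Qed.

Lemma dblZ n (X : 'M[R]_n) a : dbl (a *: X) = a *: dbl X.
Proof. by rewrite /dbl scale_block_mx !scaler0. Qed.

Lemma to_realM n (z : 'rV[R[i]]_n) (B : 'M[R]_n) :
  to_real (SO_act B z) = to_real z *m dbl B.
Proof.
rewrite /to_real /dbl mul_row_block !mulmx0 addr0 add0r.
have ReM (a : R[i]) (b : R) : complex.Re (a * real_complex R b) = complex.Re a * b.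
  by case: a => x y /=; rewrite mulr0 subr0.
have ImM (a : R[i]) (b : R) : complex.Im (a * real_complex R b) = complex.Im a * b.
  by case: a => x y /=; rewrite mulr0 add0r.
congr row_mx; apply/rowP => j; rewrite !mxE raddf_sum; apply: eq_bigr => k _.
  by rewrite !mxE; exact: ReM.
by rewrite !mxE; exact: ImM.
Qed.

Lemma cayley_continuous n (Y : 'M[R]_n) :
  {for (0 : R), continuous (fun s : R => cayley (s *: Y))}.
Proof.
have lin a : {for (0 : R), continuous (fun s : R => 1%:M + a * s *: Y)}.
  apply/continuous_mxP => i j.
  have -> : (fun s : R => (1%:M + a * s *: Y) i j) =
      (fun s => (1%:M : 'M[R]_n) i j + a * s * Y i j).
    by apply/funext => s; rewrite !mxE.
  have cc (c : R) : {for (0 : R), continuous (fun=> c)} by exact: cst_continuous.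
  apply: (continuousD (cc _)); apply: continuousM (cc _).
  by apply: continuousM (cc a) _; exact: cvg_id.
have -> : (fun s : R => cayley (s *: Y)) =
    (fun s => (1%:M + 1 * s *: Y) *m invmx (1%:M + -1 * s *: Y)).
  by apply/funext => s; rewrite /cayley mul1r mulN1r scaleNr.
apply: continuous_mulmx; first exact: lin.
apply: continuous_invmx; last exact: lin.
by rewrite mulr0 scale0r addr0 unitmx1.
Qed.

Lemma cayley_orbit_derive n (c : R -> 'rV[R]_n) (dc : 'rV[R]_n) (Y : 'M[R]_n) :
  Y^T = - Y -> is_derive (0 : R) 1 c dc ->
  s^-1 *: (c s *m cayley (s *: Y) - c 0) @[s --> 0^'] --> dc + 2 *: (c 0 *m Y).
Proof.
move=> sY [cd cE].
have K0 : cayley (s *: Y) @[s --> 0^'] --> (1%:M : 'M[R]_n).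
  have /continuous_withinNx := @cayley_continuous n Y.
  by rewrite scale0r /cayley addr0 subr0 invmx1 mulmx1.
have c0 : s^-1 *: (c s - c 0) @[s --> 0^'] --> dc.
  rewrite -cE; move: cd; rewrite /derivable /derive /=.
  have -> : (fun h : R => h^-1 *: (c (h *: 1 + 0) - c 0)) =
      (fun h => h^-1 *: (c h - c 0)).
    by apply/funext => h; rewrite addr0 [h *: 1]mulr1.
  exact.
have lim1 : s^-1 *: (c s - c 0) *m cayley (s *: Y) @[s --> (0 : R)^'] -->
    dc *m 1%:M by exact: cvg_mulmx.
have lim2 : c 0 *m (cayley (s *: Y) *m Y) @[s --> (0 : R)^'] -->
    c 0 *m (1%:M *m Y).
  apply: cvg_mulmx; first exact: cvg_cst.
  by apply: cvg_mulmx K0 _; exact: cvg_cst.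
have E : {near 0^', (fun s => s^-1 *: (c s - c 0) *m cayley (s *: Y) +
      (c 0 *m (cayley (s *: Y) *m Y) + c 0 *m Y)) =1
    (fun s => s^-1 *: (c s *m cayley (s *: Y) - c 0))}.
  near=> s; have s0 : s != 0 by near: s; exact: nbhs_dnbhs_neq.
  have sY' : (s *: Y)^T = - (s *: Y) by rewrite linearZ/= sY scalerN.
  (* This exact expansion reduces the derivative at 0 to continuity of [cayley] there; the two
     copies of [Y] give the factor 2. *)
  have KE : cayley (s *: Y) = 1%:M + s *: (Y + cayley (s *: Y) *m Y).
    have := cayleyK sY'; rewrite mulmxBr mulmx1 -scalemxAr => /eqP.
    by rewrite subr_eq -addrA -scalerDr => /eqP.
  rewrite -scalemxAl mulmxBl scalerBr scalerBr; set K := cayley (s *: Y) in KE *.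
  have -> : c 0 *m K = c 0 + s *: (c 0 *m Y + c 0 *m (K *m Y)).
    by rewrite {1}KE mulmxDr mulmx1 -scalemxAr mulmxDr.
  rewrite scalerDr scalerA mulVf// scale1r [c 0 *m (K *m Y) + _]addrC.
  by rewrite opprD [X in X + _ = _]addrA subrK.
apply: cvg_trans (near_eq_cvg E) _.
have -> : dc + 2 *: (c 0 *m Y) =
    dc *m 1%:M + (c 0 *m (1%:M *m Y) + c 0 *m Y).
  by rewrite mulmx1 mul1mx scaler_nat mulr2n.
have lim3 : c 0 *m Y @[s --> (0 : R)^'] --> c 0 *m Y by exact: cvg_cst.
exact: cvgD lim1 (cvgD lim2 lim3).
Unshelve. all: by end_near. Qed.

End Cayley.

(** * Sheets of an immersion *)

Lemma dotv_bound (R : realType) m (nu : 'rV[R]_m) :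
  exists2 K : R, 0 < K & forall v, `|dotv v nu| <= `|v| * K.
Proof.
exists (\sum_i \sum_j `|nu^T i j| + 1) => [|v].
  by rewrite ltr_wpDl//; apply: sumr_ge0 => i _; apply: sumr_ge0.
rewrite dotvE; apply: le_trans (coord_le_norm _ _) _.
by apply: le_trans (norm_mulmx_le _ _) _; rewrite ler_wpM2l// lerDl.
Qed.

Section LocalSheets.
Variables (R : realType) (n m : nat) (U : set 'rV[R]_n).
Variable f : 'rV[R]_n -> 'rV[R]_m.
Hypotheses (oU : open U) (fC2 : Ck 2 U f).
Hypothesis finj : forall x, U x -> injective ('d f x).

Lemma grad_approx x (e : R) : U x -> 0 < e ->
  \forall y \near x, `|f y - f x - (y - x) *m grad f x| <= e * `|y - x|.
Proof.
move=> Ux; apply: (C1_approx oU _ Ux).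
by have [fc fd fp] := fC2; split=> // i; have [] := fp i.
Qed.

(** Apply a right inverse [Q] of the differential to the first-order expansion. With precision
    [1 / (2 K)], the error is at most [|y - x| / 2] and is absorbed. *)
Lemma immersion_expands x : U x -> exists2 C : R, 0 < C &
  \forall y \near x, `|y - x| <= C * `|f y - f x|.
Proof.
move=> Ux; set P := grad f x.
have fP : row_free P by exact: (grad_free oU fC2 finj).
pose Q := P^T *m invmx (P *m P^T).
have PQ : P *m Q = 1%:M by rewrite /Q mulmxA mulmxV// gram_unit.
pose K : R := \sum_i \sum_j `|Q i j| + 1.
have K0 : 0 < K by rewrite ltr_wpDl//; apply: sumr_ge0 => i _; apply: sumr_ge0.
have QK (v : 'rV[R]_m) : `|v *m Q| <= `|v| * K.
  by apply: le_trans (norm_mulmx_le _ _) _; rewrite ler_wpM2l// lerDl.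
have e0 : 0 < (2 * K)^-1 by rewrite invr_gt0 mulr_gt0.
exists (2 * K); first by rewrite mulr_gt0.
have := grad_approx Ux e0; apply: filterS => y; rewrite -/P => yP.
have := QK (f y - f x - (y - x) *m P); rewrite mulmxBl -mulmxA PQ mulmx1 => h1.
have h2 := QK (f y - f x).
have h3 : `|y - x| <= `|(f y - f x) *m Q| + `|(f y - f x) *m Q - (y - x)|.
  by have := ler_normB ((f y - f x) *m Q) ((f y - f x) *m Q - (y - x)); rewrite subKr.
have h4 : `|f y - f x - (y - x) *m P| * K <= `|y - x| / 2.
  apply: le_trans (_ : (2 * K)^-1 * `|y - x| * K <= _).
    by rewrite ler_wpM2r// ltW.
  by rewrite le_eqVlt; apply/orP; left; apply/eqP; field; rewrite gt_eqF.
lra.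
Qed.

(** The error is measured by the displacement in the image, through [immersion_expands], so the
    estimate can be tested on points known only by their images. *)
Lemma normal_flat x (nu : 'rV[R]_m) (e : R) : U x -> 0 < e ->
  grad f x *m nu^T = 0 ->
  \forall y \near x, `|dotv (f y - f x) nu| <= e * `|f y - f x|.
Proof.
move=> Ux e0 Pnu; have [C C0 fC] := immersion_expands Ux.
have [K K0 nuK] := dotv_bound nu.
have d0 : 0 < e / (C * K) by rewrite divr_gt0// mulr_gt0.
near=> y; have yC : `|y - x| <= C * `|f y - f x| by near: y.
have yP : `|f y - f x - (y - x) *m grad f x| <= e / (C * K) * `|y - x|.
  by near: y; exact: grad_approx.
have -> : dotv (f y - f x) nu = dotv (f y - f x - (y - x) *m grad f x) nu.
  by rewrite [RHS]dotvBl [X in _ = _ - X]dotvE -mulmxA Pnu mulmx0 mxE subr0.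
apply: le_trans (nuK _) _; rewrite -ler_pdivlMr//.
apply: le_trans yP _.
apply: le_trans (_ : e / (C * K) * (C * `|f y - f x|) <= _).
  by rewrite ler_wpM2l// ltW.
by rewrite le_eqVlt; apply/orP; left; apply/eqP; field; rewrite !gt_eqF.
Unshelve. all: by end_near. Qed.

End LocalSheets.

Lemma poly_eq0_infinite (R : realType) (q : {poly R}) :
  (forall N : nat, exists2 j : nat, (N <= j)%N & root q j%:R) -> q = 0.
Proof.
move=> rq; apply/eqP/negPn/negP => q0.
have [s [ss us sr]] : exists s : seq nat,
    [/\ size s = size q, uniq s & forall j, j \in s -> root q j%:R].
  elim: (size q) => [|k [s [ss us sr]]]; first by exists [::].
  have [j jN jr] := rq (\max_(i <- s) i).+1.
  exists (j :: s); split; [by rewrite /= ss| |].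
    rewrite /= us andbT; apply/negP => js.
    have : (j <= \max_(i <- s) i)%N by exact: leq_bigmax_seq.
    by rewrite leqNgt jN.
  by move=> i; rewrite inE => /orP[/eqP->|/sr].
have /(max_poly_roots q0) : all (root q) [seq (j%:R : R) | j <- s].
  by apply/allP => _ /mapP[j js ->]; exact: sr.
rewrite map_inj_uniq => [/(_ us)|i j /eqP]; first by rewrite size_map ss ltnn.
by rewrite eqr_nat => /eqP.
Qed.

(** * Tangent directions to the image of a compact immersed manifold *)

Section ImmersedManifold.
Variables (R : realType) (n m : nat) (M : topologicalType).
Variables (A : set (chart R n M)) (psi : M -> 'rV[R]_m).
Hypothesis Achart : forall c, A c -> is_chart c.
Hypothesis Acover : forall p : M, exists2 c, A c & chart_dom c p.
Hypothesis psi_imm : immersion A psi.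

Local Notation local c := (psi \o chart_inv c).

Lemma cod_open c : A c -> open (chart_cod c).
Proof. by move=> /Achart[]. Qed.

Lemma local_C2 c : A c -> Ck 2 (chart_cod c) (local c).
Proof. by move=> Ac; have [/(_ 2%N)] := psi_imm Ac. Qed.

Lemma local_C1 c : A c -> Ck 1 (chart_cod c) (local c).
Proof. by move=> Ac; have [/(_ 1%N)] := psi_imm Ac. Qed.

Lemma local_inj c : A c -> forall x, chart_cod c x -> injective ('d (local c) x).
Proof. by move=> Ac; have [] := psi_imm Ac. Qed.

Lemma mem_cod (c : chart R n M) p : chart_dom c p -> chart_cod c (chart_map c p).
Proof. by move=> cp; exists p. Qed.

Lemma local_map c p : A c -> chart_dom c p -> local c (chart_map c p) = psi p.
Proof. by move=> /Achart[_ _ cK _ _] cp; rewrite /= cK. Qed.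

Lemma near_chart c p (Q : 'rV[R]_n -> Prop) : A c -> chart_dom c p ->
  (\forall y \near chart_map c p, Q y) ->
  \forall q \near p, chart_dom c q /\ Q (chart_map c q).
Proof.
move=> Ac cp Qp; have [od _ _ cc _] := Achart Ac.
have cpc : {for p, continuous (chart_map c)}.
  by move: cc; rewrite continuous_open_subspace// => /(_ p); apply; rewrite inE.
apply: filterI; first exact: open_nbhs_nbhs.
exact: cpc Qp.
Qed.

Lemma psi_near p (Q : 'rV[R]_m -> Prop) :
  (\forall z \near psi p, Q z) -> \forall q \near p, Q (psi q).
Proof.
have [c Ac cp] := Acover p; rewrite -(local_map Ac cp) => Qp.
have [fc _ _] := local_C2 Ac.
have := near_chart Ac cp (fc _ (mem_cod cp) _ Qp).
by apply: filterS => q [cq]; rewrite /= -/(local c _) local_map.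
Qed.

Lemma psi_continuous p : {for p, continuous psi}.
Proof. by move=> Q; exact: psi_near. Qed.

Lemma psi_locally_injective p : \forall q \near p, psi q = psi p -> q = p.
Proof.
have [c Ac cp] := Acover p; have Ux := mem_cod cp.
have [C C0] := immersion_expands (cod_open Ac) (local_C2 Ac) (local_inj Ac) Ux.
move=> /(near_chart Ac cp); apply: filterS => q [cq].
rewrite !local_map// => h qp; move: h; rewrite qp subrr normr0 mulr0.
rewrite normr_le0 subr_eq0 => /eqP E.
by have [_ _ cK _ _] := Achart Ac; rewrite -(cK q)// E cK.
Qed.

(** Normality in one chart around [p] is enough for [psi_normal_flat], so no comparison of charts
    enters. *)
Definition normal_at (p : M) (nu : 'rV[R]_m) : Prop :=
  exists2 c, A c /\ chart_dom c p & grad (local c) (chart_map c p) *m nu^T = 0.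

Lemma psi_normal_flat p (nu : 'rV[R]_m) (e : R) : normal_at p nu -> 0 < e ->
  \forall q \near p, `|dotv (psi q - psi p) nu| <= e * `|psi q - psi p|.
Proof.
move=> [c [Ac cp] Pnu] e0; have Ux := mem_cod cp.
have := normal_flat (cod_open Ac) (local_C2 Ac) (local_inj Ac) Ux e0 Pnu.
move=> /(near_chart Ac cp); apply: filterS => q [cq].
by rewrite !local_map.
Qed.

Hypothesis Mcompact : compact [set: M].

Lemma cluster_seq (q : nat -> M) : exists p : M, forall B, nbhs p B ->
  forall N : nat, exists2 j, (N <= j)%N & B (q j).
Proof.
have [|p [_ pc]] := @Mcompact (q @ \oo) _; first exact: filterT.
exists p => B pB N.
have [|z [[j /= Nj <-] Bz]] := pc (q @` [set j | (N <= j)%N]) B _ pB.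
  by exists N => // j /= Nj; exists j.
by exists j.
Qed.

Lemma invS_lt (e : R) : 0 < e -> exists N : nat, forall j, (N <= j)%N ->
  (j.+1%:R^-1 : R) < e.
Proof.
move=> e0; have [N _ NP] := near_infty_natSinv_lt (PosNum e0).
by exists N => j Nj; exact: NP.
Qed.

(* A curve in the image need not lift to [M], but its velocity is tangent to
   some sheet through the limit point. *)
Lemma tangent_direction (c : R -> 'rV[R]_m) (z xi : 'rV[R]_m) :
  (\forall s \near 0^', range psi (c s)) ->
  s^-1 *: (c s - z) @[s --> 0^'] --> xi ->
  exists2 p, psi p = z & forall nu, normal_at p nu -> dotv xi nu = 0.
Proof.
move=> cpsi cxi; have x1 : 0 < `|xi| + 1 by rewrite ltr_wpDl.
have seqE (j : nat) : exists ps : M * R, [/\ psi ps.1 = c ps.2, ps.2 != 0,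
    `|ps.2| < j.+1%:R^-1 & `|xi - ps.2^-1 *: (c ps.2 - z)| < j.+1%:R^-1].
  have j0 : 0 < (j.+1%:R^-1 : R) by rewrite invr_gt0.
  have : \forall s \near (0 : R)^', [/\ range psi (c s), s != 0,
      `|s| < j.+1%:R^-1 & `|xi - s^-1 *: (c s - z)| < j.+1%:R^-1].
    near=> s; split; near: s => //.
    - exact: nbhs_dnbhs_neq.
    - exact: dnbhs0_lt.
    - by move/cvgrPdist_lt : cxi; exact.
  move=> near_s; have [s [[p _ ps] s0 sj xj]] := @filter_ex _ _ (Proper_dnbhs_numFieldType (0 : R)) _ near_s.
  by exists (p, s).
have [ps psP] := choice seqE.
have [p pc] := cluster_seq (fun j => (ps j).1).
have psE j : psi (ps j).1 - z = (ps j).2 *: ((ps j).2^-1 *: (c (ps j).2 - z)).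
  by have [pE s0 _ _] := psP j; rewrite scalerA mulfV// scale1r pE.
have psb j : `|(ps j).2^-1 *: (c (ps j).2 - z)| <= `|xi| + 1.
  have [_ _ _ xj] := psP j.
  rewrite -[X in `|X|](subKr xi); apply: le_trans (ler_normB _ _) _.
  by rewrite lerD2l (le_trans (ltW xj))// invf_le1 ?ler1n.
(* The displacements [psi (ps j).1 - z] are [s_j] times bounded difference quotients, with [s_j]
   tending to 0. *)
have pz : psi p = z.
  apply/eqP; rewrite -subr_eq0 -normr_eq0; apply/negP => /negP e0.
  have {}e0 : 0 < `|psi p - z| by rewrite lt_def e0 normr_ge0.
  set e := `|_| in e0.
  have [N NP] : exists N : nat, forall j, (N <= j)%N ->
      (j.+1%:R^-1 : R) < e / 2 / (`|xi| + 1).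
    by apply: invS_lt; rewrite !divr_gt0// ltr_wpDl.
  have pB : \forall q \near p, `|psi q - psi p| < e / 2.
    apply: (@psi_near _ (fun z => `|z - psi p| < e / 2)).
    by apply: (nbhs_distP _ _).2; exists (e / 2) => //; rewrite divr_gt0.
  have [j Nj qj] := pc _ pB N; have [pE s0 sj xj] := psP j.
  have : `|psi (ps j).1 - z| < e / 2.
    rewrite psE normrZ.
    apply: (@le_lt_trans _ _ (j.+1%:R^-1 * (`|xi| + 1))).
      by apply: ler_pM => //; exact: ltW.
    by have := NP j Nj; rewrite (ltr_pdivlMr _ _ x1).
  move=> h; have := ler_normD (psi p - psi (ps j).1) (psi (ps j).1 - z).
  rewrite subrKA -/e leNgt => /negP; apply.
  by rewrite (splitr e) distrC ltrD.
exists p => // nu nup; apply/eqP; rewrite -normr_eq0; apply/negP => /negP e0.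
have {}e0 : 0 < `|dotv xi nu| by rewrite lt_def e0 normr_ge0.
set e := `|_| in e0; have [K K0 nuK] := dotv_bound nu.
have [N NP] : exists N : nat, forall j, (N <= j)%N -> (j.+1%:R^-1 : R) < e / 2 / K.
  by apply: invS_lt; rewrite !divr_gt0.
have d0 : 0 < e / 2 / (`|xi| + 1) by rewrite !divr_gt0.
have [j Nj qj] := pc _ (psi_normal_flat nup d0) N.
have [_ s0 _ xj] := psP j; move: qj; rewrite pz psE.
set X := _ *: (c _ - z) in xj *; have Xb : `|X| <= `|xi| + 1 := psb j.
(* The factor [|s_j|] cancels, so flatness of the sheet becomes a bound on the difference quotient
   [X], which is close to [xi]. *)
rewrite dotvZl normrM normrZ mulrCA ler_pM2l ?normr_gt0// => X1.
have X2 : `|dotv X nu| <= e / 2.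
  by apply: le_trans X1 _; rewrite mulrAC ler_pdivrMr// ler_wpM2l// divr_ge0// ltW.
have X3 : `|dotv (xi - X) nu| < e / 2.
  apply: le_lt_trans (nuK _) _; rewrite -ltr_pdivlMr//.
  exact: lt_trans xj (NP j Nj).
have := ler_normD (dotv (xi - X) nu) (dotv X nu).
rewrite -dotvDl subrK -/e leNgt => /negP; apply.
by rewrite (splitr e) ltr_leD.
Unshelve. all: by end_near. Qed.

(** The sheet may vary with [j], but [psi] is locally injective, so a cluster point [p] of these
    sheets equals infinitely many of them. For [nu] normal at [p], the polynomial with coefficients
    [C *m nu^T] then has infinitely many roots, so all rows of [C] are tangent at [p]. *)
Lemma tangent_rows k (C : 'M[R]_(k, m)) (z : 'rV[R]_m) :
  (forall j : nat, exists2 p, psi p = z & forall nu, normal_at p nu ->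
     dotv ((\row_(i < k) j%:R ^+ i) *m C) nu = 0) ->
  exists2 p, psi p = z & forall nu, normal_at p nu -> C *m nu^T = 0.
Proof.
move=> jC; have jE (j : nat) : exists p, psi p = z /\ forall nu, normal_at p nu ->
    dotv ((\row_(i < k) j%:R ^+ i) *m C) nu = 0.
  by have [p] := jC j; exists p.
have [q qP] := choice jE.
have [p pc] := cluster_seq q.
have pz : psi p = z.
  apply/eqP; rewrite -subr_eq0 -normr_eq0; apply/negP => /negP e0.
  have {}e0 : 0 < `|psi p - z| by rewrite lt_def e0 normr_ge0.
  have pB : \forall q \near p, `|psi q - psi p| < `|psi p - z|.
    apply: (@psi_near _ (fun y => `|y - psi p| < `|psi p - z|)).
    by apply: (nbhs_distP _ _).2; exists `|psi p - z|.
  by have [j _] := pc _ pB 0%N; rewrite (qP j).1 distrC ltxx.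
exists p => // nu nup.
pose P := \poly_(i < k) (if insub i is Some i' then (C *m nu^T) i' 0 else 0).
have P0 : P = 0.
  apply: poly_eq0_infinite => N.
  have [j Nj qj] := pc _ (psi_locally_injective p) N; exists j => //.
  have [qz qnu] := qP j; have qp : q j = p by apply: qj; rewrite qz.
  have := qnu nu; rewrite qp => /(_ nup); rewrite dotvE -mulmxA mxE => E.
  apply/rootP; rewrite horner_poly -[RHS]E; apply: eq_bigr => i _.
  by rewrite valK mulrC !mxE.
apply/colP => i; rewrite [RHS]mxE.
have := congr1 (fun Q : {poly R} => Q`_i) P0.
by rewrite coef_poly ltn_ord valK coef0.
Qed.

Variable Y : 'M[R]_m.
Hypothesis skewY : Y^T = - Y.
Hypothesis psi_inv : forall (t : R) z,
  range psi z -> range psi (z *m cayley (t *: Y)).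

(** A single sheet through [f x] is found whose tangent space contains both the tangent space of the
    given sheet and [f x *m Y]; equality of dimensions identifies the two tangent spaces. *)
Lemma orbit_tangent c x nu : A c -> chart_cod c x ->
  grad (local c) x *m nu^T = 0 -> dotv (local c x *m Y) nu = 0.
Proof.
move=> Ac Ux xnu; set f := local c; pose P := grad f x.
have [p cp px] := Ux.
have fx : f x = psi p by rewrite -px /f local_map.
pose C := col_mx P (f x *m Y).
have [p' p'z p'C] : exists2 p', psi p' = f x & forall nu, normal_at p' nu ->
    C *m nu^T = 0.
  apply: tangent_rows => j.
  (* The curve [f (x + s v) cayley (s lam Y)] has velocity [v P + 2 lam (f x) Y]. These choices make
     it the combination of the rows of [C] with weights [1, j, ..., j^n]. *)
  pose v : 'rV[R]_n := \row_(i < n) j%:R ^+ i.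
  pose lam : R := j%:R ^+ n / 2.
  have fl := line_derive (cod_open Ac) (local_C1 Ac) (x := x) (b := v) (t := 0).
  rewrite scale0r addr0 in fl; have {}fl := fl Ux.
  have sY : (lam *: Y)^T = - (lam *: Y) by rewrite linearZ/= skewY scalerN.
  have lim := cayley_orbit_derive sY fl.
  have [|q qz qnu] := tangent_direction _ lim.
    have [d d0 dU] := line_near v (cod_open Ac) Ux.
    near=> s; rewrite scalerA; apply: psi_inv.
    have /dU[r cr rE] : `|s| < d by near: s; exact: dnbhs0_lt.
    by exists r => //; rewrite -rE local_map.
  exists q; first by rewrite qz scale0r addr0.
  move=> nu' /qnu; rewrite scale0r addr0 -/f -/P => <-; congr dotv.
  rewrite -[X in X *m C]hsubmxK /C mul_row_col; congr (_ + _).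
    by congr (_ *m _); apply/rowP => i; rewrite !mxE.
  rewrite [rsubmx _]mx11_scalar mul_scalar_mx -scalemxAr scalerA mulrC divfK//.
  by rewrite !mxE /= addn0.
have [d Ad dp'] := Acover p'; pose P' := grad (local d) (chart_map d p').
have fP' : row_free P'.
  by apply: (grad_free (cod_open Ad) (local_C2 Ad) (local_inj Ad)); exact: mem_cod dp'.
have fP : row_free P.
  by apply: (grad_free (cod_open Ac) (local_C2 Ac) (local_inj Ac)); exact: Ux.
have P'n (nu' : 'rV[R]_m) : P' *m nu'^T = 0 -> C *m nu'^T = 0 by move=> ?; apply: p'C; exists d.
(* The part of the given tangent basis normal to the new sheet; its rows are normal at [p'], hence
   orthogonal to those of [P], which forces [W = 0]. *)
pose W := P - P *m tproj P'.
have P'W : P' *m W^T = 0.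
  by rewrite /W linearB/= trmx_mul tproj_sym mulmxBr mulmxA mulmx_tproj// subrr.
have PW : P *m W^T = 0.
  apply/matrixP => k i; have : C *m (row i W)^T = 0.
    by apply: P'n; rewrite tr_row colE mulmxA P'W mul0mx.
  rewrite mul_col_mx tr_row colE !mulmxA -!colE => /(congr1 (fun v => usubmx v k 0)).
  by rewrite col_mxKu [LHS]mxE => ->; rewrite !mxE.
have W0 : W = 0.
  have WW : W *m W^T = 0.
    by rewrite {1}/W mulmxBl PW /tproj -!mulmxA P'W !mulmx0 subrr.
  apply/row_matrixP => i; rewrite row0; apply/eqP; rewrite -dotv_eq0 dotvE.
  by rewrite tr_row colE mulmxA -row_mul WW row0 mul0mx mxE.
pose D := P *m P'^T *m invmx (P' *m P'^T).
have PD : P = D *m P'.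
  rewrite -[LHS](subrK (P *m tproj P')) -/W W0 add0r /tproj /D.
  by rewrite !mulmxA.
have uD : D \in unitmx.
  rewrite -row_free_unit; apply: inj_row_free => v vD.
  by apply: (row_free_inj fP); rewrite mul0mx PD mulmxA vD mul0mx.
have : C *m nu^T = 0.
  by apply: P'n; rewrite -[P'](mulKmx uD) -PD -mulmxA xnu mulmx0.
rewrite mul_col_mx => /(congr1 (fun v => dsubmx v 0 0)).
by rewrite col_mxKd -dotvE !mxE.
Unshelve. all: by end_near. Qed.

End ImmersedManifold.

(** * Lagrangian solitons *)

Section QuadraticCritical.
Variables (R : realType) (n m : nat) (U : set 'rV[R]_n).
Variable f : 'rV[R]_n -> 'rV[R]_m.
Hypotheses (oU : open U) (fC2 : Ck 2 U f).
Hypothesis finj : forall x, U x -> injective ('d f x).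
Variable S : 'M[R]_m.
Hypothesis symS : S^T = S.

(** When the first derivatives vanish throughout [U], so do the second ones, and the Laplacian
    formula equals 0. *)
Lemma quad_stationary x : U x -> (forall y b, U y -> quad_D1 f S y b = 0) ->
  2 * dotv (f x *m S) (mean_curvature f x) + 2 * \tr (S *m tproj (grad f x)) = 0.
Proof.
move=> Ux D10; rewrite -(quad_laplacian oU fC2 finj)// D10// subr0.
apply: big1 => k _; set b := row k _.
have [_ /(_ x b Ux)[_ <-]] := quad_C2 oU fC2 symS.
have [d d0 dU] := line_near b oU Ux.
have E : \forall s \near (0 : R), quad_D1 f S (x + s *: b) b = cst 0 s.
  apply: (nbhs_distP _ _).2; exists d => // s; rewrite subr0 => /dU Us.
  exact: D10.
by rewrite (@near_eq_derive R R R _ (cst 0) 0 1 E) derive_cst.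
Qed.

Lemma quad_local_max x : U x -> (\forall y \near x, quad f S y <= quad f S x) ->
  2 * dotv (f x *m S) (mean_curvature f x) + 2 * \tr (S *m tproj (grad f x)) <= 0.
Proof.
move=> Ux xmax; have test b := local_max_derivatives b oU Ux (quad_C2 oU fC2 symS) xmax.
rewrite -(quad_laplacian oU fC2 finj)// (test _).1 subr0.
by apply: sumr_le0 => k _; exact: (test _).2.
Qed.

Lemma quad_strong_maximum x : U x ->
  (forall y, U y ->
    2 * dotv (f y *m S) (mean_curvature f y) + 2 * \tr (S *m tproj (grad f y)) = 0) ->
  (forall y, U y -> quad f S y <= quad f S x) ->
  \forall y \near x, quad f S y = quad f S x.
Proof.
move=> Ux L0 xmax.
have gc y : U y -> {for y, continuous (fun z => invmx (first_form f z))}.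
  move=> Uy; apply: continuous_invmx; first exact: (first_form_unit oU fC2 finj).
  exact: first_form_continuous Uy.
have gradc y (Uy : U y) := continuous_tr (grad_continuous fC2 Uy).
apply: (@strong_maximum _ _ _ U (quad f S) (quad_D1 f S) (quad_D2 f S)
    (frame f) (drift f) oU (quad_C2 oU fC2 symS)).
- by move=> y Uy; exact: quad_continuous Uy.
- by move=> y Uy; exact: continuous_mulmx (gradc y Uy) (gc y Uy).
- move=> y Uy; have tc := unnormalized_mean_continuous oU fC2 finj Uy.
  exact: continuous_mulmx (continuous_mulmx tc (gradc y Uy)) (gc y Uy).
(* Ellipticity: the principal part is the inverse metric [frame^T *m frame], whose invertibility
   makes [frame^T] injective on row vectors. *)
- move=> y v Uy v0; rewrite mulmxA dotv_mull; apply: dotv_gt0.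
  apply: contra_neq v0 => vF.
  have : v *m (frame f y)^T *m frame f y = 0 by rewrite vF mul0mx.
  rewrite -mulmxA (frame_gram oU fC2 finj)// => /(congr1 (mulmxr (first_form f y))).
  by rewrite /= mul0mx mulmxKV// (first_form_unit oU fC2 finj).
- by move=> y Uy; rewrite (quad_laplacian oU fC2 finj)// L0.
- exact: Ux.
- exact: xmax.
Qed.

End QuadraticCritical.

Section SolitonPoint.
Variables (R : realType) (n : nat) (U : set 'rV[R]_n).
Variable f : 'rV[R]_n -> 'rV[R]_(n + n).
Hypotheses (oU : open U) (fC2 : Ck 2 U f).
Hypothesis finj : forall x, U x -> injective ('d f x).
Hypothesis lagf : forall x, U x -> forall u v, omega ('d f x u) ('d f x v) = 0.
Variable a : R.
Hypothesis a0 : a != 0.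
Hypothesis solf : forall x, U x -> mean_curvature f x != 0 /\
  - ((dotv (mean_curvature f x) (mean_curvature f x))^-1 *: mean_curvature f x) =
  a *: normal_part f x (f x).

Local Notation J := (cplxJ_mx R n).
Local Notation P := (grad f).
Local Notation H := (mean_curvature f).

Lemma grad_lagrangian x : U x -> P x *m J *m (P x)^T = 0.
Proof.
move=> Ux; apply/matrixP => i j; rewrite [RHS]mxE.
have := lagf Ux (delta_mx 0 i) (delta_mx 0 j).
rewrite /omega cplxJE !(diffE_grad oU fC2)// dotvE trmx_mul.
rewrite !mulmxA => <-; rewrite -!mulmxA -rowE mulmxA mulmxA.
by rewrite trmx_delta -colE !mxE; apply: eq_bigr => k _; rewrite !mxE.
Qed.

Lemma mean_normal x : U x -> H x *m (P x)^T = 0.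
Proof.
move=> Ux; rewrite (mean_curvatureE oU fC2 finj)// mulmxBl -mulmxA.
by rewrite tproj_tr ?subrr// (grad_free oU fC2 finj).
Qed.

(** Pair the soliton equation with H: the left side becomes -1, and on the right the tangential part
    of the position drops out. *)
Lemma position_mean x : U x -> dotv (f x) (H x) = - a^-1.
Proof.
move=> Ux; have [H0 E] := solf Ux; have HP := mean_normal Ux.
have HH : dotv (H x) (H x) != 0 by rewrite dotv_eq0.
have : dotv (normal_part f x (f x)) (H x) = dotv (f x) (H x).
  have Z : dotv (f x *m tproj (P x)) (H x) = 0.
    by rewrite /tproj mulmxA dotv_mull HP dotv0r.
  by rewrite (normal_partE oU fC2 finj)// dotvBl Z subr0.
move=> <-; have := congr1 (fun v => dotv v (H x)) E.
rewrite dotvNl !dotvZl mulVf// => aE.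
by apply: (mulfI a0); rewrite -aE mulrN mulfV.
Qed.

Lemma position_normal x : U x ->
  f x - f x *m tproj (P x) = - (a * dotv (H x) (H x))^-1 *: H x.
Proof.
move=> Ux; have [H0 E] := solf Ux.
rewrite -(normal_partE oU fC2 finj)// -[LHS]scale1r -(mulVf a0) -scalerA -E.
by rewrite scalerN scalerA -invfM scaleNr.
Qed.

Lemma position_neq0 x : U x -> f x != 0.
Proof.
move=> Ux; have [H0 _] := solf Ux; have := position_normal Ux.
apply: contra_eq_neq => ->; rewrite mul0mx subrr eq_sym scaler_eq0 oppr_eq0.
by rewrite invr_eq0 mulf_eq0 (negbTE a0) dotv_eq0 (negbTE H0).
Qed.

(** The position is a tangent vector plus a multiple of H, and [f x *m S] is orthogonal to both. *)
Lemma normal_part_quad (S : 'M[R]_(n + n)) x : U x ->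
  f x *m S *m (P x)^T = 0 -> dotv (f x *m S) (H x) = 0 ->
  dotv (f x *m S) (f x) = 0.
Proof.
move=> Ux SP SH; rewrite -[X in dotv _ X](subrK (f x *m tproj (P x))) dotvDr.
rewrite position_normal// dotvZr SH mulr0 add0r dotvC dotv_mull tproj_sym.
by rewrite /tproj !mulmxA SP !mul0mx dotv0r.
Qed.

Lemma dblJ_comm (X : 'M[R]_n) : dbl X *m J = J *m dbl X.
Proof.
rewrite /dbl /cplxJ_mx !mulmx_block !mulmx0 !mul0mx !mulmx1 !mul1mx !addr0 !add0r.
by rewrite mulmxN mulNmx mulmx1 mul1mx.
Qed.

(* The quadratic form [w |-> omega (w X) w] is the moment map of [X]; being
   J-invariant and trace-free, it vanishes on a soliton where it is constant. *)
Lemma moment_zero (X : 'M[R]_n) : X^T = - X ->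
  (forall x nu, U x -> P x *m nu^T = 0 -> dotv (f x *m dbl X) nu = 0) ->
  forall x, U x -> dotv (f x *m (dbl X *m J)) (f x) = 0.
Proof.
move=> sX tanX x Ux; set S := dbl X *m J.
have symS : S^T = S.
  by rewrite /S trmx_mul cplxJ_mxN dbl_skew// mulmxN mulNmx opprK dblJ_comm.
(* Moving J to the other side pairs [f y *m dbl X] with J applied to a tangent vector, which is
   normal by the Lagrangian condition. *)
have SP y : U y -> f y *m S *m (P y)^T = 0.
  move=> Uy; apply: dotv_eq0P => v.
  rewrite dotv_mull trmxK /S mulmxA dotv_mull tanX//.
  by rewrite trmx_mul trmxK trmx_mul !mulmxA grad_lagrangian// mul0mx.
have D10 y b : U y -> quad_D1 f S y b = 0.
  by move=> Uy; rewrite /quad_D1 dotvC dotv_mull SP// ?dotv0r ?mulr0.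
have := quad_stationary oU fC2 finj symS Ux D10.
rewrite lagrangian_trace ?mulr0 ?addr0.
- move=> /eqP; rewrite mulf_eq0 pnatr_eq0 /= => /eqP.
  exact: normal_part_quad Ux (SP x Ux).
- exact: (grad_free oU fC2 finj).
- exact: grad_lagrangian.
- by rewrite /S [RHS]mulmxA -dblJ_comm.
- rewrite /S /dbl /cplxJ_mx mulmx_block !mulmx0 !mul0mx !addr0 !add0r.
  by rewrite mxtrace_block !mxtrace0 addr0.
Qed.

Lemma sqnorm_laplacian x : U x ->
  2 * dotv (f x *m 1%:M) (H x) + 2 * \tr (1%:M *m tproj (P x)) =
  2 * (n%:R - a^-1).
Proof.
move=> Ux; rewrite mulmx1 mul1mx position_mean// /tproj mxtrace_mulC mulmxA mulmxV.
  by rewrite mxtrace1; lra.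
by rewrite gram_unit// (grad_free oU fC2 finj).
Qed.

End SolitonPoint.

Lemma near_all (T : nbhsType) (x : T) (Q : T -> Prop) : Filter (nbhs x) ->
  (forall y, Q y) -> \forall y \near x, Q y.
Proof. by move=> F HQ; exact: filterE. Qed.

Lemma dotv_row_mx (R : realType) p q (a b : 'rV[R]_p) (c d : 'rV[R]_q) :
  dotv (row_mx a c) (row_mx b d) = dotv a b + dotv c d.
Proof. by rewrite !dotvE tr_row_mx mul_row_col mxE. Qed.

(** Test with [X = u^T v - v^T u]: [u *m X] is the difference of the two sides, orthogonal to [v] by
    hypothesis and to [u] by skewness, hence to itself. *)
Lemma skew_annihilator (R : realType) n (u v : 'rV[R]_n) :
  (forall X : 'M[R]_n, X^T = - X -> dotv (u *m X) v = 0) ->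
  dotv u u *: v = dotv u v *: u.
Proof.
move=> uXv; have sc (a b : 'rV[R]_n) : a *m b^T = (dotv a b)%:M.
  by rewrite dotvE -mx11_scalar.
pose X := u^T *m v - v^T *m u.
have sX : X^T = - X by rewrite /X linearB/= !trmx_mul !trmxK opprB.
have uX : u *m X = dotv u u *: v - dotv u v *: u.
  by rewrite /X mulmxBr !mulmxA !sc !mul_scalar_mx.
apply/eqP; rewrite -subr_eq0 -uX -dotv_eq0 {2}uX dotvBr !dotvZr uXv//.
by rewrite skew_dotv// ?mulr0 ?subr0// [dotv _ u]skew_dotv.
Qed.

(** If [y != 0] then [x = k y]; normalising [(k, 1)] by [s = sqrt (k^2 + 1)] gives cosine [k / s],
    sine [1 / s] and [al = s y]. The sine is positive, so [acos] yields the right angle. *)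
Lemma parallel_phase (R : realType) n (x y : 'rV[R]_n) :
  (forall X : 'M[R]_n, X^T = - X -> dotv (x *m X) y = 0) ->
  exists t (al : 'rV[R]_n), x = cos t *: al /\ y = sin t *: al.
Proof.
move=> xXy; have [->|y0] := eqVneq y 0.
  by exists 0, x; rewrite cos0 sin0 scale1r scale0r.
have yXx X : X^T = - X -> dotv (y *m X) x = 0.
  by move=> sX; rewrite dotv_mull sX mulmxN dotvNr dotvC xXy ?oppr0.
have yy0 : dotv y y != 0 by rewrite dotv_eq0.
pose k := dotv y x / dotv y y.
have xE : x = k *: y.
  by rewrite /k mulrC -scalerA -(skew_annihilator yXx) scalerA mulVf// scale1r.
have k1 : 0 < k ^+ 2 + 1 by rewrite ltr_wpDl// sqr_ge0.
pose s := Num.sqrt (k ^+ 2 + 1).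
have s0 : 0 < s by rewrite sqrtr_gt0.
have s2 : s ^+ 2 = k ^+ 2 + 1 by rewrite sqr_sqrtr// ltW.
have ks : -1 <= k / s <= 1.
  rewrite -ler_norml normrM normfV (gtr0_norm s0) ler_pdivrMr// mul1r.
  by rewrite -ler_sqr ?nnegrE ?(ltW s0)// real_normK ?num_real// s2 lerDl.
exists (acos (k / s)), (s *: y); rewrite acosK// sin_acos//; split.
  by rewrite scalerA divfK ?gt_eqF.
rewrite scalerA (_ : _ * s = 1) ?scale1r//.
have -> : 1 - (k / s) ^+ 2 = s^-1 ^+ 2.
  rewrite exprMn; apply: (mulIf (x := s ^+ 2)); first by rewrite expf_neq0 ?gt_eqF.
  by rewrite mulrBl mul1r -mulrA -exprMn mulVf ?gt_eqF// expr1n mulr1 s2; ring.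
by rewrite sqrtr_sqr ger0_norm ?invr_ge0 ?(ltW s0)// mulVf ?gt_eqF.
Qed.

Lemma to_real_inj (R : realType) n : injective (@to_real R n).
Proof.
move=> z w /eq_row_mx[/rowP re /rowP im]; apply/rowP => i.
apply/eqP; rewrite eq_complex; have := re i; have := im i.
by rewrite !mxE => -> ->; rewrite !eqxx.
Qed.

Lemma to_real_hopf (R : realType) n (r t : R) (x : 'rV[R]_n) :
  to_real (r%:C%C *: hopf t x) =
  row_mx (cos t *: ((r * Num.sqrt n%:R) *: x)) (sin t *: ((r * Num.sqrt n%:R) *: x)).
Proof.
by congr row_mx; apply/rowP => i; rewrite !mxE /=; ring.
Qed.

(** * Global conclusions on the closed manifold *)

Section LagrangianSoliton.
Variables (R : realType) (n : nat) (M : topologicalType).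
Variables (A : set (chart R n M)) (phi : M -> 'rV[R[i]]_n).
Local Notation psi := (@to_real R n \o phi).
Local Notation local c := (psi \o chart_inv c).
Local Notation J := (cplxJ_mx R n).

Hypothesis Achart : forall c, A c -> is_chart c.
Hypothesis Acover : forall p : M, exists2 c, A c & chart_dom c p.
Hypothesis imm : immersion A psi.
Hypothesis Mcompact : compact [set: M].
Hypothesis Mconn : connected [set: M].
Hypothesis M0 : [set: M] !=set0.
Hypothesis lag : lagrangian A psi.
Variable a : R.
Hypothesis a0 : a != 0.
Hypothesis sol : forall c x, A c -> chart_cod c x ->
  let f := local c in let H := mean_curvature f x in
  H != 0 /\ - ((dotv H H)^-1 *: H) = a *: normal_part f x (f x).
Hypothesis inv : SO_invariant phi.

Let oU c (Ac : A c) := cod_open Achart Ac.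
Let fC2 c (Ac : A c) := local_C2 imm Ac.
Let finj c (Ac : A c) := local_inj imm Ac.
Let flag c (Ac : A c) x (Ux : chart_cod c x) := lag Ac Ux.
Let fsol c (Ac : A c) x (Ux : chart_cod c x) := sol Ac Ux.

Lemma range_cayley (X : 'M[R]_n) : X^T = - X -> forall (t : R) z,
  range psi z -> range psi (z *m cayley (t *: dbl X)).
Proof.
move=> sX t _ [p _ <-].
have stX : (t *: X)^T = - (t *: X) by rewrite linearZ/= sX scalerN.
rewrite -dblZ -dbl_cayley// -to_realM.
have : (SO_act (cayley (t *: X)) @` range phi) (SO_act (cayley (t *: X)) (phi p)).
  by exists (phi p) => //; exists p.
rewrite inv; last exact: cayley_special.
by move=> [q _ qE]; exists q => //=; rewrite qE.
Qed.

Lemma moment_psi (X : 'M[R]_n) p : X^T = - X ->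
  dotv (psi p *m (dbl X *m J)) (psi p) = 0.
Proof.
move=> sX; have [c Ac cp] := Acover p.
rewrite -(local_map psi Achart Ac cp).
apply: (moment_zero (oU Ac) (fC2 Ac) (finj Ac) (flag Ac) a0 (fsol Ac) sX) => //.
  move=> x nu Ux; apply: (orbit_tangent Achart Acover imm Mcompact) => //.
    exact: dbl_skew.
  exact: range_cayley.
exact: mem_cod.
Qed.

Lemma quad_psi_continuous (S : 'M[R]_(n + n)) p :
  {for p, continuous (fun q => dotv (psi q *m S) (psi q))}.
Proof.
have pc := @psi_continuous _ _ _ _ _ _ Achart Acover imm p.
have Sc : {for p, continuous (fun=> S)} by exact: cst_continuous.
exact: continuous_dotv (continuous_mulmx pc Sc) pc.
Qed.

Lemma quad_psi_max (S : 'M[R]_(n + n)) : exists p : M,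
  forall q, dotv (psi q *m S) (psi q) <= dotv (psi p *m S) (psi p).
Proof.
have [|p _ pmax] := compact_argmax M0 Mcompact (F := fun q => dotv (psi q *m S) (psi q)).
  by move=> q _; exact: quad_psi_continuous.
by exists p => q; exact: pmax.
Qed.

Lemma soliton_constant : n%:R - a^-1 = 0 :> R.
Proof.
apply/eqP; rewrite eq_le; apply/andP; split.
  have [p pmax] := quad_psi_max 1%:M; have [c Ac cp] := Acover p.
  have Ux := mem_cod cp.
  have := quad_local_max (oU Ac) (fC2 Ac) (finj Ac) (@trmx1 _ _) Ux.
  rewrite (sqnorm_laplacian (oU Ac) (fC2 Ac) (finj Ac) a0 (fsol Ac) Ux).
  rewrite pmulr_rle0//; apply; apply: near_all => y.
  by rewrite /quad (local_map psi Achart Ac cp); exact: pmax.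
(* A maximum for the form [- 1%:M] is a minimum of the squared length. *)
have [p pmax] := quad_psi_max (- 1%:M); have [c Ac cp] := Acover p.
have Ux := mem_cod cp.
have s1 : (- 1%:M : 'M[R]_(n + n))^T = - 1%:M by rewrite linearN/= trmx1.
have := quad_local_max (oU Ac) (fC2 Ac) (finj Ac) s1 Ux.
have := sqnorm_laplacian (oU Ac) (fC2 Ac) (finj Ac) a0 (fsol Ac) Ux.
rewrite mulmxN mulNmx dotvNl linearN/= => E h.
suff : 2 * (n%:R - a^-1) >= 0 by rewrite pmulr_rge0.
rewrite -E; suff : forall u v : R, 2 * - u + 2 * - v <= 0 -> 0 <= 2 * u + 2 * v.
  apply; apply: h; apply: near_all => y.
  by rewrite /quad (local_map psi Achart Ac cp); exact: pmax.
by move=> u v; lra.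
Qed.

(** The squared length is harmonic by [soliton_constant], so its maximum set is open by the strong
    maximum principle; it is also closed and nonempty, and [M] is connected. *)
Lemma sqnorm_constant p q : dotv (psi p) (psi p) = dotv (psi q) (psi q).
Proof.
have [m mmax] := quad_psi_max 1%:M.
suff K : [set r | dotv (psi r) (psi r) = dotv (psi m) (psi m)] = [set: M].
  have Kp r : dotv (psi r) (psi r) = dotv (psi m) (psi m).
    by have : [set: M] r by []; rewrite -K.
  by rewrite !Kp.
set K := [set r | _]; apply: Mconn; first by exists m.
- exists K; last by rewrite setTI.
  rewrite openE => r Kr; have [c Ac cr] := Acover r; have Ux := mem_cod cr.
  have := quad_strong_maximum (oU Ac) (fC2 Ac) (finj Ac) (@trmx1 _ _) Ux.
  rewrite /quad !(local_map psi Achart Ac cr) => smax.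
  have {smax} : \forall y \near chart_map c r,
      dotv (local c y *m 1%:M) (local c y) = dotv (psi r *m 1%:M) (psi r).
    apply: smax => y Uy.
      rewrite (sqnorm_laplacian (oU Ac) (fC2 Ac) (finj Ac) a0 (fsol Ac) Uy).
      by rewrite soliton_constant mulr0.
    rewrite (_ : dotv (psi r *m _) _ = dotv (psi m *m 1%:M) (psi m)).
      exact: mmax.
    by rewrite !mulmx1.
  move=> /(near_chart Achart Ac cr); apply: filterS => s [cs].
  by rewrite (local_map psi Achart Ac cs) !mulmx1 => E; rewrite /K /= E.
- exists K; last by rewrite setTI.
  have uc : continuous (fun r => dotv (psi r) (psi r)).
    move=> r; have psir := @psi_continuous _ _ _ _ _ _ Achart Acover imm r.
    exact: (continuous_dotv psir psir).
  apply: (@preimage_closed _ _ _ [set dotv (psi m) (psi m)]) => [r _|]; first exact: uc.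
  exact: closed_eq.
Qed.

Lemma psi_neq0 p : psi p != 0.
Proof.
have [c Ac cp] := Acover p; rewrite -(local_map psi Achart Ac cp).
by apply: (position_neq0 (oU Ac) (fC2 Ac) (finj Ac) a0 (fsol Ac)); exact: mem_cod.
Qed.

Lemma J_tangent c x : A c -> chart_cod c x ->
  exists b, b *m grad (local c) x = local c x *m J.
Proof.
move=> Ac Ux; have fP : local c x *m (grad (local c) x)^T = 0.
  apply: dotv_eq0P => b.
  (* For a constant squared length every point is a local maximum, so the position is orthogonal to
     all tangent vectors. *)
  have := local_max_derivatives b (oU Ac) Ux (quad_C2 (oU Ac) (fC2 Ac) (@trmx1 _ _)).
  rewrite /quad_D1 mulmx1 => /(_ _)[|+ _].
    apply: near_all => y; rewrite /quad !mulmx1.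
    by rewrite (sqnorm_constant (chart_inv c y) (chart_inv c x)).
  by move=> /eqP; rewrite mulf_eq0 pnatr_eq0 /= dotv_mull trmxK => /eqP.
have gf := grad_free (oU Ac) (fC2 Ac) (finj Ac) Ux.
have := lagrangian_normalJ gf (grad_lagrangian (oU Ac) (fC2 Ac) (flag Ac) Ux) fP.
rewrite /tproj !mulmxA => E.
by eexists; exact: E.
Qed.

(** [w *m phase t] is Re(e^{-it} w), and [w *m J *m phase t] is -Im(e^{-it} w). *)
Definition phase (t : R) : 'M[R]_(n + n, n) :=
  col_mx (cos t)%:M (sin t)%:M.

Lemma phaseE t (x y : 'rV[R]_n) :
  row_mx x y *m phase t = cos t *: x + sin t *: y.
Proof. by rewrite mul_row_col !mul_mx_scalar. Qed.

Lemma phase_decomp t (w : 'rV[R]_(n + n)) (al := w *m phase t)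
    (be := w *m J *m phase t) :
  w = row_mx (cos t *: al + sin t *: be) (sin t *: al - cos t *: be).
Proof.
rewrite /al /be -[w]hsubmxK; set x := lsubmx w; set y := rsubmx w.
rewrite [row_mx x y *m J]mul_row_block !mulmx0 mulmx1 mulmxN mulmx1 add0r addr0.
rewrite !phaseE; congr row_mx; apply/rowP => i; rewrite !mxE.
  by rewrite -[LHS]mul1r -(cos2Dsin2 t); ring.
by rewrite -[LHS]mul1r -(cos2Dsin2 t); ring.
Qed.

Lemma moment_coords (X : 'M[R]_n) p : X^T = - X ->
  dotv (lsubmx (psi p) *m X) (rsubmx (psi p)) = 0.
Proof.
move=> sX; have := moment_psi p sX; rewrite -{1 2}(hsubmxK (psi p)).
set x := lsubmx (psi p); set y := rsubmx (psi p).
rewrite mulmxA !mul_row_block !mulmx0 !mulmx1 !addr0 !add0r mulmxN mulmx1.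
rewrite dotv_row_mx dotvNl [dotv (y *m X) x]dotv_mull sX mulmxN dotvNr.
by rewrite [dotv y _]dotvC; lra.
Qed.

(** The moment map is unchanged when the position is multiplied by e^{-it}. *)
Lemma moment_phase t (X : 'M[R]_n) p : X^T = - X ->
  dotv (psi p *m phase t *m X) (psi p *m J *m phase t) = 0.
Proof.
move=> sX; have xy := moment_coords p sX.
rewrite -(hsubmxK (psi p)); move: xy.
set x := lsubmx (psi p); set y := rsubmx (psi p) => xy.
rewrite [row_mx x y *m J]mul_row_block !mulmx0 mulmx1 mulmxN mulmx1 add0r addr0.
rewrite !phaseE mulmxDl -!scalemxAl !dotvDl !dotvDr !dotvZl !dotvZr !dotvNr.
rewrite !skew_dotv// xy [dotv (y *m X) x]dotv_mull sX mulmxN dotvNr dotvC xy.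
by ring.
Qed.

Lemma phase_attained t : exists p, psi p *m J *m phase t = 0.
Proof.
pose S := phase t *m (phase t)^T.
have symS : S^T = S by rewrite /S trmx_mul trmxK.
have SE w : dotv (w *m S) w = dotv (w *m phase t) (w *m phase t).
  by rewrite /S mulmxA dotv_mull trmxK.
have [p pmax] := quad_psi_max S; exists p.
have [c Ac cp] := Acover p; have Ux := mem_cod cp.
have [b bE] := J_tangent Ac Ux.
have := local_max_derivatives b (oU Ac) Ux (quad_C2 (oU Ac) (fC2 Ac) symS).
move=> /(_ _)[|].
  by apply: near_all => y; rewrite /quad (local_map psi Achart Ac cp); exact: pmax.
rewrite /quad_D1 /quad_D2 bE (local_map psi Achart Ac cp) => D1 D2.
set al := psi p *m phase t; set be := psi p *m J *m phase t.
have ab : dotv al be = 0.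
  move/eqP: D1; rewrite mulf_eq0 pnatr_eq0 /= => /eqP.
  by rewrite /S mulmxA dotv_mull trmxK.
(* If [al = 0], the first-order condition is void, but the second derivative along J phi reduces to
   [2 |be|^2] and is nonpositive at a maximum. Otherwise [be] is both orthogonal and parallel to
   [al]. *)
have [al0|al0] := eqVneq al 0.
  have fS : psi p *m S = 0 by rewrite /S mulmxA -/al al0 mul0mx.
  move: D2; rewrite fS dotv0l mulr0 addr0 SE -/be pmulr_rle0// => be0.
  by apply/eqP; rewrite -dotv_eq0 eq_le be0 dotv_ge0.
have := @skew_annihilator _ _ al be (fun X sX => moment_phase t p sX).
by rewrite ab scale0r => /eqP; rewrite scaler_eq0 dotv_eq0 (negbTE al0) => /eqP.
Qed.

Theorem range_soliton : (2 <= n)%N -> exists2 rho : R, 0 < rho &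
  range phi = [set (rho%:C)%C *: z | z in @hopf_image R n].
Proof.
move=> n2; have [p0 _] := M0; pose r := Num.sqrt (dotv (psi p0) (psi p0)).
have r0 : 0 < r by rewrite sqrtr_gt0 dotv_gt0// psi_neq0.
have rE q : dotv (psi q) (psi q) = r ^+ 2.
  by rewrite sqr_sqrtr ?dotv_ge0// (sqnorm_constant q p0).
have sn0 : 0 < Num.sqrt (n%:R : R) by rewrite sqrtr_gt0 ltr0n (leq_trans _ n2).
have al_norm q t (al : 'rV[R]_n) :
    psi q = row_mx (cos t *: al) (sin t *: al) -> dotv (r^-1 *: al) (r^-1 *: al) = 1.
  move=> qE; have := rE q; rewrite qE dotv_row_mx !dotvZl !dotvZr !mulrA -!expr2.
  rewrite -mulrDl cos2Dsin2 mul1r => ->.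
  by rewrite -exprMn mulVf ?expr1n// gt_eqF.
(* The image lies on the sphere of radius [r], the Hopf image on that of radius [sqrt n]. *)
exists (r / Num.sqrt n%:R); first by rewrite divr_gt0.
apply/seteqP; split=> [_ [q _ <-]|_ [_ [t [x xx ->]] <-]].
  have [t [al [qx qy]]] := parallel_phase (fun X sX => moment_coords q sX).
  have qE : psi q = row_mx (cos t *: al) (sin t *: al) by rewrite -qx -qy hsubmxK.
  exists (hopf t (r^-1 *: al)); first by exists t, (r^-1 *: al) => //; exact: al_norm qE.
  apply: to_real_inj; rewrite to_real_hopf divfK ?gt_eqF// [r *: _]scalerA.
  by rewrite mulfV ?gt_eqF// scale1r -qE.
(* For the reverse inclusion, one point of phase [t] suffices: a rotation carries its real direction
   to [x]. *)
have [q qt] := phase_attained t; set al := psi q *m phase t.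
have qE : psi q = row_mx (cos t *: al) (sin t *: al).
  by rewrite {1}(phase_decomp t (psi q)) qt !scaler0 addr0 subr0.
have [B SB uB] := specialO_transitive n2 (al_norm _ _ _ qE) xx.
have : (SO_act B @` range phi) (SO_act B (phi q)) by exists (phi q) => //; exists q.
rewrite inv// => -[q' _ q'E]; exists q' => //.
rewrite q'E; apply: to_real_inj; rewrite to_realM -/(psi q) qE to_real_hopf.
rewrite divfK ?gt_eqF// /dbl mul_row_block !mulmx0 addr0 add0r -!scalemxAl.
have -> : al *m B = r *: x.
  by rewrite -uB -scalemxAl scalerA mulfV ?gt_eqF// scale1r.
by [].
Qed.

End LagrangianSoliton.

Theorem corollary3p10 (R : realType) (n : nat) (M : topologicalType)
    (A : set (chart R n M)) (phi : M -> 'rV[R[i]]_n)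
    (n_ge2 : (2 <= n)%N)
    (manifoldM : smooth_manifold A)
    (closedM : closed_connected M)
    (immersion_phi : immersion A (@to_real R n \o phi))
    (lagrangian_phi : lagrangian A (@to_real R n \o phi))
    (soliton_phi : imcf_homothetic_soliton A (@to_real R n \o phi))
    (invariant_phi : SO_invariant phi) :
  exists2 rho : R, 0 < rho &
    range phi = [set (rho%:C)%C *: z | z in @hopf_image R n].
Proof.
have [_ _ [Achart Acover _]] := manifoldM.
have [M0 Mconn Mcompact] := closedM.
have [a a0 sol] := soliton_phi.
exact: (range_soliton Achart Acover immersion_phi Mcompact Mconn M0
  lagrangian_phi a0 sol invariant_phi n_ge2).
Qed.
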